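(* For any $\alpha\in(0,1)$ the system $([0,1],T_\alpha,\mu_\alpha)$ has exponential return time statistics (around balls), where $T_\alpha:[0,1]\to[0,1]$ is defined by $$T_\alpha(x)=\begin{cases}x(1+2^\alpha x^\alpha)& x\in[0,1/2),\\ 2x-1&\text{otherwise,}\end{cases}$$ and $\mu_\alpha$ is the $T_\alpha$-invariant probability measure absolutely continuous with respect to Lebesgue measure.
   Context: Exponential return time statistics (around balls) for $(X,T,\mu)$ means: for $\mu$-a.e. $z\in X$, $$\sup_{t\ge0}\left|\mu_{U_r(z)}\left(\left\{x\in U_r(z):\tau_{U_r(z)}(x)>\frac{t}{\mu(U_r(z))}\right\}\right)-e^{-t}\right|\to0\quad\text{as } r\to0,$$ where $U_r(z)$ is the ball of radius $r$ centred at $z$, $\mu_A=\mu(\cdot\cap A)/\mu(A)$, and $\tau_A(x)=\min\{n\ge1:T^n(x)\in A\}$. The absolutely continuous invariant probability measure $\mu_\alpha$ is known to exist for $\alpha\in(0,1)$. *)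

(* Defs.v *)
From mathcomp Require Import all_boot all_order all_algebra.
From mathcomp Require Import all_classical all_reals all_analysis.
Import Order.TTheory GRing.Theory Num.Theory.
Import numFieldNormedType.Exports.

Set Implicit Arguments.
Unset Strict Implicit.
Unset Printing Implicit Defensive.

Local Open Scope classical_set_scope.
Local Open Scope ring_scope.

(* A system (X, T, mu) with X a subset of the real line is encoded by a map
   T : R -> R, of which only the values on X matter, and a Borel probability
   mu on R with mu X = 1. *)

(* Equal to +oo when the orbit of x never returns to A. *)
Definition return_time (R : realType) (T : R -> R) (A : set R) (x : R) : \bar R :=
  ereal_inf [set (n%:R)%:E | n in [set n : nat | (1 <= n)%N /\ A (iter n T x)]].

(* The value is the junk 0 when mu A = 0. *)
Definition cond_prob (R : realType) (mu : probability (measurableTypeR R) R)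
    (A B : set R) : R :=
  fine (mu (B `&` A)) / fine (mu A).

Definition ball_in (R : realType) (X : set R) (z r : R) : set R :=
  ball z r `&` X.

Definition return_time_error (R : realType) (T : R -> R)
    (mu : probability (measurableTypeR R) R) (U : set R) : R :=
  sup [set `| cond_prob mu U
                [set x | U x /\ ((t / fine (mu U))%:E < return_time T U x)%E]
              - expR (- t) | | t in [set t : R | 0 <= t]].

Definition exponential_return_time_statistics (R : realType) (X : set R)
    (T : R -> R) (mu : probability (measurableTypeR R) R) : Prop :=
  {ae mu, forall z, X z ->
    return_time_error T mu (ball_in X z r) @[r --> 0^'+] --> (0 : R)}.

Definition invariant_measure (R : realType) (T : R -> R)
    (mu : probability (measurableTypeR R) R) : Prop :=
  forall A : set R, measurable A -> mu (T @^-1` A) = mu A.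

(* Meant for x in [0, 1], which it maps to itself. *)
Definition T_alpha (R : realType) (alpha x : R) : R :=
  if (0 <= x) && (x < 2^-1) then x * (1 + 2 `^ alpha * x `^ alpha)
  else 2 * x - 1.

(* Main.v *)
From HB Require Import structures.
Require Import Defs.
From mathcomp Require Import all_boot all_order all_algebra.
From mathcomp Require Import all_classical all_reals all_analysis.
From mathcomp Require Import measurable_realfun.
From mathcomp Require Import ring lra zify.
Import Order.TTheory GRing.Theory Num.Theory.
Import numFieldNormedType.Exports.
Local Open Scope classical_set_scope.
Local Open Scope ring_scope.

Set Implicit Arguments.
Unset Strict Implicit.
Unset Printing Implicit Defensive.

(** Write [lam] for Lebesgue measure on [[0, 1[], [g] for the inverse of the
left branch of [T], and [a n] for [g^n(1)], which decreases to the neutral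
fixed point 0.

For a set [U] of small measure [m], the numbers [p n = mu (avoids n)], where
[avoids n] means no visit to [U] at the times [1, ..., n], satisfy
[p n - p n.+1 = mu (U `&` avoids n)] by invariance.  If the right-hand side is
close to [m * p n], then [p n] is close to [exp (- n m)], and so is the
conditional probability [mu (U `&` avoids n) / m]
([return_time_exponential]).  Such a decorrelation holds as soon as, for some
[N] with [N m] small, few points of [U] come back within [N] steps and
[mu (U `&` T^-N V)] is close to [m * mu V] uniformly in [V]
([avoids_decorrelation]).  Both have to be found for the balls around almost
every point.

Uniform mixing.  Laws are handled through their distribution functions
[F x = nu [0, x[].  The image under [T] has distribution function
[F (g x) + F ((1 + x) / 2) - F (1 / 2)], and since both inverse branches are
concave this preserves concavity.  A concave [F] with little mass near 0 has a
slope bounded below on [[0, a q]]; after [q] more steps this cylinder covers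
the whole interval, so a fixed multiple of [lam] can be split off.  Repetition
leaves a remainder of mass at most [rho], at a time that does not depend on [F]
([pushn_mixing]), and two laws with the same split off part are [rho]-close in
total variation ([common_part_bound]).  The mass near 0 stays small because
the mass that enters [[0, a p]] at the various times is at most the tail of
the sum of the [a k], which converges exactly because [alpha < 1]
([pushn_tight], [sum_a_bounded]).  The uniform law on a ball is not concave,
but the left end of the ball can be moved to an end point of a cylinder of
level [k], at the cost of a length [a k], and then the law is concave after
[k] steps ([cylinder_endpoint]).

Choice of the time.  Fix [theta] between [alpha] and 1.  There is a [k] for
which [a k] is negligible against [r], [k r] is negligible, and
[2 r <= (a k)^theta] ([time_scale]); [N] is [2 k] plus a constant.  Points
that come back within [N] steps are excluded by a Borel-Cantelli argument: the
set of [x] with [|T^j x - x| <= u] and [T^j x] away from 0 has measure at most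
a constant times [u] ([lam_self_return]), and the sum over [j] of
[(a (j / 4))^theta] converges.  A second Borel-Cantelli argument excludes
orbits that are closer to 0 than [a n] at time [n]
([no_long_excursion_ge]); this is what keeps the law of the ball away from 0
at time [k].  Both arguments give sets of full measure, of which almost every
[z] is a density point.

Passage to [mu].  At a Lebesgue point [z] of the density [h] of [mu] with
[h z > 0], [mu] is close to [h z * lam] on small balls ([lebesgue_pt_ball]).
The target measure [mu V] is close to [lam (T^-n V)] because [mu] is invariant
and every measurable set equidistributes under [lam] ([mu_equidistribution]).
*)

(** * Concave functions on an interval *)

Section Clamp.
Context {R : realType}.
Implicit Types (F : R -> R) (x y : R).

(** Composition with [clamp] extends a function on [[0, 1]] by constants, which
turns it into a function on the line to which the intermediate value theorem
and the Lebesgue-Stieltjes construction apply. *)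
Definition clamp x := Num.max 0 (Num.min 1 x).

Lemma clamp_range x : 0 <= clamp x <= 1.
Proof.
rewrite /clamp /Num.max /Num.min.
by case: (ltP 1 x) => ?; case: ltP => ?; lra.
Qed.

Lemma clampE x : 0 <= x <= 1 -> clamp x = x.
Proof. by case/andP=> x0 x1; rewrite /clamp (min_idPr x1) (max_idPr x0). Qed.

Lemma clamp_nondecreasing x y : x <= y -> clamp x <= clamp y.
Proof.
move=> xy; rewrite /clamp /Num.max /Num.min.
by case: (ltP 1 x) => ?; case: (ltP 1 y) => ?; do 2! case: ltP => ?; lra.
Qed.

Lemma clamp_contract x y : x <= y -> clamp y - clamp x <= y - x.
Proof.
move=> xy; rewrite /clamp /Num.max /Num.min.
by case: (ltP 1 x) => ?; case: (ltP 1 y) => ?; do 2! case: ltP => ?; lra.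
Qed.

Lemma clamp_continuous F (L : R) : 0 <= L ->
  (forall x y, 0 <= x -> x <= y -> y <= 1 -> 0 <= F y - F x <= L * (y - x)) ->
  continuous (fun x => F (clamp x)).
Proof.
move=> L0 hF.
have hc x y : x <= y -> `|F (clamp y) - F (clamp x)| <= L * (y - x).
  move=> xy; have := clamp_range x; have := clamp_range y.
  have := clamp_nondecreasing xy => h1 h2 h3.
  have /andP[p q] := hF _ _ (proj1 (andP h3)) h1 (proj2 (andP h2)).
  rewrite ger0_norm//; apply: (le_trans q); rewrite ler_wpM2l//.
  exact: clamp_contract.
move=> x; apply/cvgrPdist_le => e e0; near=> y.
have Ly : (L + 1) * `|x - y| <= e.
  rewrite -ler_pdivlMl; last lra.
  near: y; apply: (@cvgr_dist_le _ _ _ _ _ id) => //; rewrite mulr_gt0// invr_gt0; lra.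
apply: le_trans Ly; have [xy|yx] := leP x y.
  rewrite distrC (distrC x) (ger0_norm (_ : 0 <= y - x)); last lra.
  apply: (le_trans (hc _ _ xy)); rewrite ler_wpM2r//; lra.
rewrite (ger0_norm (_ : 0 <= x - y)); last lra.
apply: (le_trans (hc _ _ (ltW yx))); rewrite ler_wpM2r//; lra.
Unshelve. all: by end_near. Qed.

End Clamp.

Section Concave.
Context {R : realType}.
Implicit Types (F G : R -> R) (a x y t : R).

(** The left end varies because a law carried by [[a, 1[] with [a > 0] may have a
distribution function that is concave only from [a] on. *)
Definition concave_on a F := forall x y t, a <= x <= 1 -> a <= y <= 1 ->
  0 <= t <= 1 -> t * F x + (1 - t) * F y <= F (t * x + (1 - t) * y).

Definition nondecreasing_on a F :=
  forall x y, a <= x -> x <= y -> y <= 1 -> F x <= F y.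

Lemma concave_on_between a F x y z : concave_on a F ->
  a <= x -> x <= y -> y <= z -> z <= 1 ->
  (F z - F y) * (y - x) <= (F y - F x) * (z - y).
Proof.
move=> cF ax xy yz z1.
have [xz|] := ltP x z; last first.
  move=> zx; have yE : y = x by apply/eqP; rewrite eq_le; lra.
  by rewrite yE (_ : z = x) ?subrr//; apply/eqP; rewrite eq_le; lra.
have zx0 : 0 < z - x by lra.
have := cF x z ((z - y) / (z - x)).
have t0 : 0 <= (z - y) / (z - x) by rewrite divr_ge0; lra.
have t1 : (z - y) / (z - x) <= 1 by rewrite ler_pdivrMr//; lra.
have -> : (z - y) / (z - x) * x + (1 - (z - y) / (z - x)) * z = y.
  by field; lra.
move=> /(_ ltac:(lra) ltac:(lra) ltac:(lra)).
rewrite -(ler_pM2r zx0).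
have -> : ((z - y) / (z - x) * F x + (1 - (z - y) / (z - x)) * F z) * (z - x)
  = (z - y) * F x + (y - x) * F z by field; lra.
lra.
Qed.

Lemma concave_on_slopes_apart a F x y u v : concave_on a F ->
  a <= x -> x <= y -> y <= u -> u <= v -> v <= 1 ->
  (F v - F u) * (y - x) <= (F y - F x) * (v - u).
Proof.
move=> cF ax xy yu uv v1.
have := concave_on_between cF ax xy yu (le_trans uv v1).
have := concave_on_between cF (le_trans ax xy) yu uv v1.
have [uyE|uy] := eqVneq u y.
  by subst u => _ _; exact: (concave_on_between cF ax xy uv v1).
have uy0 : 0 < u - y by rewrite subr_gt0 lt_neqAle eq_sym uy.
move=> h1 h2; rewrite -(ler_pM2r uy0).
have h3 : (F v - F u) * (u - y) * (y - x) <= (F u - F y) * (v - u) * (y - x).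
  by rewrite ler_wpM2r//; lra.
have h4 : (F u - F y) * (y - x) * (v - u) <= (F y - F x) * (u - y) * (v - u).
  by rewrite ler_wpM2r//; lra.
lra.
Qed.

(** Chords get flatter to the right.  The inequality of slopes is cross-multiplied
so that degenerate intervals need no special treatment. *)
Lemma concave_on_slopes a F x y u v : concave_on a F ->
  a <= x -> x <= y -> u <= v -> x <= u -> y <= v -> v <= 1 ->
  (F v - F u) * (y - x) <= (F y - F x) * (v - u).
Proof.
move=> cF ax xy uv xu yv v1.
have [yu|uy] := leP y u; first exact: (concave_on_slopes_apart cF).
have h1 := concave_on_between cF ax xu (ltW uy) (le_trans yv v1).
have h2 := concave_on_between cF (le_trans ax xu) (ltW uy) yv v1.
have h3 := concave_on_slopes_apart cF ax xu (ltW uy) yv v1.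
lra.
Qed.

Lemma concave_on_comp a F b G : concave_on a F -> nondecreasing_on a F ->
  concave_on b G -> (forall x, b <= x <= 1 -> a <= G x <= 1) ->
  concave_on b (fun x => F (G x)).
Proof.
move=> cF nF cG rG x y t hx hy ht.
have hc : b <= t * x + (1 - t) * y <= 1 by nra.
apply: (le_trans (cF _ _ _ (rG _ hx) (rG _ hy) ht)).
have := rG _ hc; have := rG _ hx; have := rG _ hy.
by move=> ? ? ?; apply: nF; [nra|exact: cG|lra].
Qed.

Lemma concave_onD a F G : concave_on a F -> concave_on a G ->
  concave_on a (fun x => F x + G x).
Proof.
move=> cF cG x y t hx hy ht.
have := cF x y t hx hy ht; have := cG x y t hx hy ht; lra.
Qed.

Lemma nondecreasing_onD a F G : nondecreasing_on a F -> nondecreasing_on a G ->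
  nondecreasing_on a (fun x => F x + G x).
Proof. by move=> nF nG x y ax xy y1; rewrite lerD ?nF ?nG. Qed.

End Concave.

(** * The operator on distribution functions *)
(** The inverse of an increasing convex branch from [[0, 1/2]] onto [[0, 1]] whose
slopes lie between 1 and 3.  The upper bound 3 is what makes the inverse
expand distances at least by [3^-1], which fixes how much of Lebesgue measure
can be split off below. *)
Record full_branch {R : realType} (g : R -> R) : Prop := FullBranch {
  branch0 : g 0 = 0;
  branch1 : g 1 = 2^-1;
  branch_concave : concave_on 0 g;
  branch_expand : forall x y, 0 <= x -> x <= y -> y <= 1 ->
    3^-1 * (y - x) <= g y - g x;
  branch_contract : forall x y, 0 <= x -> x <= y -> y <= 1 ->
    g y - g x <= y - x;
  branch_surj : forall w, 0 <= w -> w < 2^-1 ->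
    exists2 v, 0 <= v < 1 & g v = w }.

Arguments branch_concave {R g} _ x y t : rename.

Section Operator.
Context {R : realType} {g : R -> R} (gP : full_branch g).
Implicit Types (F G K : R -> R) (x y : R) (n p q : nat).

(** If [F] is [x |-> nu [0, x[], this is the same function for the image of [nu]
under the map with inverse branches [g] and [x |-> (1 + x) / 2]. *)
Definition push F x := F (g x) + F ((1 + x) / 2) - F 2^-1.
(** [[0, a_ n[] consists of the points that stay in the left branch during the
first [n] steps. *)
Definition a_ n := iter n g 1.

Lemma branch_mono x y : 0 <= x -> x <= y -> y <= 1 -> g x <= g y.
Proof. move=> x0 xy y1; have := branch_expand gP x0 xy y1; lra. Qed.

Lemma branch_ge0 x : 0 <= x <= 1 -> 0 <= g x.
Proof.
by case/andP=> x0 x1; have := branch_mono (lexx 0) x0 x1; rewrite (branch0 gP).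
Qed.

Lemma branch_le_half x : 0 <= x <= 1 -> g x <= 2^-1.
Proof.
by case/andP=> x0 x1; have := branch_mono x0 x1 (lexx 1); rewrite (branch1 gP).
Qed.

Lemma branch_range x : 0 <= x <= 1 -> 0 <= g x <= 1.
Proof. move=> h; have := branch_ge0 h; have := branch_le_half h; lra. Qed.

Lemma branch_ge_half x : 0 <= x <= 1 -> x / 2 <= g x.
Proof.
move=> h; have := branch_concave gP 1 0 x.
rewrite !mulr1 !mulr0 !addr0 branch0// branch1// mulr0 addr0; apply; lra.
Qed.

(** A concave function vanishing at 0 grows most when started from 0; hence the
cylinder at 0 is the longest one of its level. *)
Lemma branch_subadd u v : 0 <= u -> u <= v -> v <= 1 -> g v - g u <= g (v - u).
Proof.
move=> u0 uv v1; have [->|vu] := eqVneq v u.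
  by rewrite !subrr branch_ge0//; lra.
have vu0 : 0 < v - u by rewrite subr_gt0 lt_neqAle eq_sym vu.
have := concave_on_slopes (x := 0) (y := v - u) (u := u) (v := v) (branch_concave gP).
rewrite (branch0 gP) !subr0 ler_pM2r//; apply; lra.
Qed.

Lemma a_range n : 0 <= a_ n <= 1.
Proof. by elim: n => [|n ih] /=; [rewrite ler01 lexx|exact: branch_range]. Qed.

Lemma aS n : a_ n.+1 = g (a_ n). Proof. by []. Qed.

Lemma push_nondecreasing F :
  nondecreasing_on 0 F -> nondecreasing_on 0 (push F).
Proof.
move=> nF x y x0 xy y1; rewrite /push.
have gx : 0 <= g x <= 1 by apply: branch_range; lra.
have gy : 0 <= g y <= 1 by apply: branch_range; lra.
have := nF _ _ (proj1 (andP gx)) (branch_mono x0 xy y1) (proj2 (andP gy)).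
have := nF ((1 + x) / 2) ((1 + y) / 2).
by move=> /(_ ltac:(lra) ltac:(lra) ltac:(lra)); lra.
Qed.

(** Both inverse branches are concave and [F] is concave and nondecreasing; in terms
of densities, the image of a nonincreasing density is nonincreasing. *)
Lemma push_concave F :
  concave_on 0 F -> nondecreasing_on 0 F -> concave_on 0 (push F).
Proof.
move=> cF nF; apply: concave_onD; last first.
  by move=> x y t _ _ _; lra.
apply: concave_onD.
- by apply: (concave_on_comp cF nF (branch_concave gP)) => x; exact: branch_range.
- apply: (concave_on_comp cF nF) => [x y t _ _ _|x ?]; lra.
Qed.

Lemma push0 F : push F 0 = F 0.
Proof. by rewrite /push (branch0 gP) addr0 mul1r; lra. Qed.

Lemma push1 F : push F 1 = F 1.
Proof.
by rewrite /push (branch1 gP) (_ : (1 + 1) / 2 = 1 :> R); [lra|field].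
Qed.

Definition pushn n F := iter n push F.

Lemma pushnS n F : pushn n.+1 F = push (pushn n F). Proof. by []. Qed.

Lemma pushnSr n F : pushn n.+1 F = pushn n (push F).
Proof. exact: iterSr. Qed.

Lemma pushnD n p F : pushn (n + p) F = pushn n (pushn p F).
Proof. exact: iterD. Qed.

Lemma pushn0 n F : pushn n F 0 = F 0.
Proof. by elim: n => // n ih; rewrite pushnS push0. Qed.

Lemma pushn1 n F : pushn n F 1 = F 1.
Proof. by elim: n => // n ih; rewrite pushnS push1. Qed.

Lemma pushn_nondecreasing n F :
  nondecreasing_on 0 F -> nondecreasing_on 0 (pushn n F).
Proof. by move=> nF; elim: n => // n ih; exact: push_nondecreasing. Qed.

Lemma pushn_concave n F :
  concave_on 0 F -> nondecreasing_on 0 F -> concave_on 0 (pushn n F).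
Proof.
move=> cF nF; elim: n => // n ih; apply: push_concave => //.
exact: pushn_nondecreasing.
Qed.

Lemma pushnDf n F G :
  pushn n (fun x => F x + G x) = (fun x => pushn n F x + pushn n G x).
Proof.
by elim: n => // n ih; apply/funext => x; rewrite !pushnS ih /push; lra.
Qed.

Lemma pushnBf n F G :
  pushn n (fun x => F x - G x) = (fun x => pushn n F x - pushn n G x).
Proof.
by elim: n => // n ih; apply/funext => x; rewrite !pushnS ih /push; lra.
Qed.

Lemma branch_iter_range n x : 0 <= x <= 1 -> 0 <= iter n g x <= 1.
Proof. by move=> h; elim: n => //= n ih; exact: branch_range. Qed.

Lemma branch_iter_expand n x y : 0 <= x -> x <= y -> y <= 1 ->
  3^-1 ^+ n * (y - x) <= iter n g y - iter n g x.
Proof.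
move=> x0 xy y1; elim: n => [|n ih]; first by rewrite expr0 mul1r.
have hx : 0 <= iter n g x <= 1 by apply: branch_iter_range; lra.
have hy : 0 <= iter n g y <= 1 by apply: branch_iter_range; lra.
have p0 : 0 <= 3^-1 ^+ n * (y - x) by rewrite mulr_ge0 ?exprn_ge0//; lra.
have := branch_expand gP (x := iter n g x) (y := iter n g y).
move=> /(_ ltac:(lra) ltac:(lra) ltac:(lra)) /= h.
apply: le_trans h; rewrite exprS -mulrA ler_wpM2l//.
Qed.

(** The increment of [pushn n F] is a sum over the [2 ^ n] inverse branches, of which
only the leftmost one, [g^n], is kept. *)
Lemma pushn_increment n F x y : nondecreasing_on 0 F ->
  0 <= x -> x <= y -> y <= 1 ->
  F (iter n g y) - F (iter n g x) <= pushn n F y - pushn n F x.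
Proof.
move=> + x0 xy y1; elim: n F => [|n ih] F nF //.
rewrite pushnSr; apply: le_trans (ih _ (push_nondecreasing nF)).
have hx := branch_iter_range n (x := x) ltac:(lra).
have hy := branch_iter_range n (x := y) ltac:(lra).
have xyn : iter n g x <= iter n g y.
  have := branch_iter_expand n x0 xy y1.
  have : 0 <= 3^-1 ^+ n * (y - x) by rewrite mulr_ge0 ?exprn_ge0//; lra.
  lra.
have := nF ((1 + iter n g x) / 2) ((1 + iter n g y) / 2).
by move=> /(_ ltac:(lra) ltac:(lra) ltac:(lra)); rewrite /push/=; lra.
Qed.

Lemma pushn_lipschitz n F L : 0 <= L ->
  (forall x y, 0 <= x -> x <= y -> y <= 1 -> F y - F x <= L * (y - x)) ->
  exists2 L', 0 <= L' & forall x y, 0 <= x -> x <= y -> y <= 1 ->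
    pushn n F y - pushn n F x <= L' * (y - x).
Proof.
move=> L0 hF; elim: n => [|n [L' L'0 ih]]; first by exists L.
exists (L' * 2) => [|x y x0 xy y1]; first by rewrite mulr_ge0.
have hx : 0 <= g x <= 1 by apply: branch_range; lra.
have hy : 0 <= g y <= 1 by apply: branch_range; lra.
have := ih (g x) (g y) ltac:(lra) (branch_mono x0 xy y1) ltac:(lra).
have := ih ((1 + x) / 2) ((1 + y) / 2) ltac:(lra) ltac:(lra) ltac:(lra).
have : L' * (g y - g x) <= L' * (y - x).
  by rewrite ler_wpM2l//; exact: (branch_contract gP).
have : L' * ((1 + y) / 2 - (1 + x) / 2) <= L' * (y - x).
  by rewrite ler_wpM2l//; lra.
by rewrite pushnS /push; lra.
Qed.

(** A law carried by [[w', 1[] is spread by [T^N] over the images of the cylinders of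
level [N].  If [w'] separates two cylinders, then each of them is mapped onto
the whole interval, so [F] composed with each inverse branch is concave on all
of [[0, 1]].  A cylinder of level [N] is at most as long as the one at 0, so
there is such a [w'] within [a_ N] of any point. *)
Lemma cylinder_endpoint N w : 0 <= w < 1 -> exists w', [/\ w <= w',
  w' <= w + a_ N, w' <= 1 & forall F, (forall x, 0 <= x <= w' -> F x = 0) ->
    concave_on w' F -> nondecreasing_on w' F ->
    concave_on 0 (pushn N F) /\ nondecreasing_on 0 (pushn N F)].
Proof.
elim: N w => [|N ih] w w01.
  exists 1; split; rewrite /a_//=; [lra|lra|].
  move=> F F0 _ _; split => [x y t hx hy ht|x y *]; rewrite !F0; nra.
have [wl|wr] := ltP w 2^-1.
  have [v hv gv] := branch_surj gP (proj1 (andP w01)) wl.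
  have [v' [vv' v'a v'1 hF]] := ih v hv.
  have gv'1 : g v' <= 2^-1 by apply: branch_le_half; lra.
  have gv'0 : 0 <= g v' by apply: branch_ge0; lra.
  have hr x : v' <= x <= 1 -> g v' <= g x <= 1.
    move=> hx; have := branch_le_half (x := x) ltac:(lra).
    have := branch_mono (x := v') (y := x) ltac:(lra) ltac:(lra) ltac:(lra).
    lra.
  exists (g v'); split; [|rewrite -gv aS|lra|].
  - by rewrite -gv; apply: branch_mono; lra.
  - have := branch_subadd (u := v) (v := v') ltac:(lra) vv' v'1.
    have := a_range N.
    by have := branch_mono (x := v' - v) (y := a_ N) ltac:(lra) ltac:(lra);
      lra.
  move=> F F0 cF nF.
  have cFr : concave_on 0 (fun x => F ((1 + x) / 2) + - F 2^-1).
    apply: concave_onD; last by move=> x y t _ _ _; lra.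
    apply: (concave_on_comp cF nF) => [x y t _ _ _|x ?]; lra.
  have nFr : nondecreasing_on 0 (fun x => F ((1 + x) / 2) + - F 2^-1).
    by move=> x y *; rewrite lerD2r nF//; lra.
  have [] := hF (fun x => F (g x)).
  - move=> x hx; apply: F0; rewrite branch_ge0 /=; last lra.
    by apply: branch_mono; lra.
  - apply: (concave_on_comp cF nF _ hr) => x y t hx hy ht.
    by apply: (branch_concave gP); lra.
  - move=> x y hx hxy hy; apply: nF; last first.
    + by have := hr y; lra.
    + by apply: branch_mono; lra.
    + by have := hr x; lra.
  move=> cFl nFl; rewrite pushnSr.
  have -> : push F = fun x => F (g x) + (F ((1 + x) / 2) + - F 2^-1).
    by apply/funext => x; rewrite /push addrA.
  rewrite pushnDf; split.
  - by apply: concave_onD => //; exact: pushn_concave.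
  - by apply: nondecreasing_onD => //; exact: pushn_nondecreasing.
have hv : 0 <= w * 2 - 1 < 1 by lra.
have [v' [vv' v'a v'1 hF]] := ih _ hv.
exists ((1 + v') / 2); split; [lra| |lra|].
  by have := a_range N => /branch_ge_half; rewrite -aS; lra.
move=> F F0 cF nF.
have [] := hF (fun x => F ((1 + x) / 2)).
- by move=> x hx; apply: F0; lra.
- apply: (concave_on_comp cF nF) => [x y t _ _ _|x ?]; lra.
- by move=> x y hx hxy hy; apply: nF; lra.
move=> cFr nFr; rewrite pushnSr.
have Fg0 x : 0 <= x <= 1 -> F (g x) = 0.
  move=> hx; apply: F0; have := branch_ge0 hx; have := branch_le_half hx; lra.
have -> : push F = fun x => F (g x) + F ((1 + x) / 2).
  by apply/funext => x; rewrite /push (F0 2^-1) ?subr0//; lra.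
rewrite pushnDf; split.
- apply: concave_onD => //; apply: pushn_concave => [x y t hx hy ht|x y *].
    by rewrite !Fg0; nra.
  by rewrite !Fg0; lra.
- apply: nondecreasing_onD => //; apply: pushn_nondecreasing => x y *.
  by rewrite !Fg0; lra.
Qed.

(** Mass enters [[0, a_ p[] either from [[0, a_ p.+1[], or from the right of 1/2, from
an interval of length [a_ p / 2] on which the density is at most 2 because it is
nonincreasing.  Iteration adds up the contributions of the second kind. *)
Lemma pushn_tight F n p : concave_on 0 F -> nondecreasing_on 0 F ->
  F 0 = 0 -> F 1 <= 1 ->
  pushn n F (a_ p) <= F (a_ (p + n)) + \sum_(p <= k < p + n) a_ k.
Proof.
move=> cF nF F0 F1; elim: n p => [|n ih] p.
  by rewrite addn0 big_geq// addr0.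
rewrite pushnS /push -aS big_ltn ?addnS ?ltnS ?leq_addr//.
have := ih p.+1; rewrite addSn => ihp.
have hp := a_range p.
have := concave_on_slopes (pushn_concave n cF nF) (x := 0) (y := 2^-1)
  (u := 2^-1) (v := (1 + a_ p) / 2).
move=> /(_ ltac:(lra) ltac:(lra) ltac:(lra) ltac:(lra) ltac:(lra) ltac:(lra)).
rewrite pushn0 F0 subr0.
have : pushn n F 2^-1 <= 1.
  apply: le_trans F1; rewrite -(pushn1 n F).
  by apply: (pushn_nondecreasing n nF); lra.
move=> h1 h2.
have : pushn n F 2^-1 * ((1 + a_ p) / 2 - 2^-1) <= 1 * ((1 + a_ p) / 2 - 2^-1).
  by rewrite ler_wpM2r//; lra.
lra.
Qed.

(** The mass split off after [m] blocks of [q] steps: each block carries along what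
was split off before and adds [c] times Lebesgue measure. *)
Fixpoint floor_part q (c : R) m : R -> R :=
  if m is m'.+1 then fun x => pushn q (floor_part q c m') x + c * x
  else fun=> 0.

Lemma floor_part_nondecreasing q c m :
  0 <= c -> nondecreasing_on 0 (floor_part q c m).
Proof.
move=> c0; elim: m => [x y|m ih] //=.
apply: nondecreasing_onD; first exact: pushn_nondecreasing.
by move=> x y *; rewrite ler_wpM2l.
Qed.

Lemma floor_part0 q c m : floor_part q c m 0 = 0.
Proof. by elim: m => //= m ih; rewrite pushn0 ih mulr0 addr0. Qed.

Lemma floor_part1 q c m : floor_part q c m 1 = m%:R * c.
Proof.
by elim: m => /= [|m ih]; rewrite ?mul0r// pushn1 ih mulr1 -[m.+1]addn1 natrD; lra.
Qed.

(** A slope of [rho / 2], thinned by the least slope [3^-1 ^+ q] of [g^q]. *)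
Definition floor_step q (rho : R) := rho / 2 * 3^-1 ^+ q.

(** As long as the remainder has mass at least [rho], it has mass at least [rho / 2]
beyond [a_ q], hence by concavity a slope of at least [rho / 2] on [[0, a_ q]].
The branch [g^q] maps [[0, 1]] onto this interval, so [q] steps later the
remainder still dominates [floor_step q rho] times Lebesgue measure. *)
Lemma pushn_floor F q (rho : R) m : 0 < rho ->
  concave_on 0 F -> nondecreasing_on 0 F -> F 0 = 0 -> F 1 = 1 ->
  (forall n, pushn n F (a_ q) <= rho / 2) ->
  (forall i, (i < m)%N -> rho <= 1 - i%:R * floor_step q rho) ->
  let Rm x := pushn (m * q) F x - floor_part q (floor_step q rho) m x in
  concave_on 0 Rm /\ nondecreasing_on 0 Rm.
Proof.
move=> rho0 cF nF F0 F1 tF; rewrite /=; set c := floor_step q rho.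
have c0 : 0 <= c by rewrite /c /floor_step mulr_ge0 ?exprn_ge0//; lra.
elim: m => [_|m ih him] /=.
  by under eq_fun do rewrite subr0.
have [{ih}cR nR] := ih (fun i im => him i (ltnW im)).
have {}him := him m (ltnSn m).
pose Rm x := pushn (m * q) F x - floor_part q c m x.
rewrite -/Rm in cR nR.
have -> : (fun x => pushn (m.+1 * q) F x - (pushn q (floor_part q c m) x + c * x))
    = (fun x => pushn q Rm x + - (c * x)).
  by apply/funext => x; rewrite pushnBf mulSn pushnD; lra.
split; first by apply: concave_onD; [exact: pushn_concave|
  by move=> x y t _ _ _; lra].
have Rm1 : Rm 1 = 1 - m%:R * c by rewrite /Rm pushn1 F1 floor_part1.
have aq := a_range q.
have Rmq : Rm (a_ q) <= rho / 2.
  have := tF (m * q)%N.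
  have := floor_part_nondecreasing q m c0 (lexx 0) (proj1 (andP aq)) (proj2 (andP aq)).
  by rewrite floor_part0 /Rm; lra.
have slope x y : 0 <= x -> x <= y -> y <= a_ q ->
    rho / 2 * (y - x) <= Rm y - Rm x.
  move=> x0 xy yq.
  have := concave_on_slopes cR (x := x) (y := y) (u := a_ q) (v := 1).
  move=> /(_ ltac:(lra) ltac:(lra) ltac:(lra) ltac:(lra) ltac:(lra) ltac:(lra)).
  have h1 : rho / 2 * (y - x) <= (Rm 1 - Rm (a_ q)) * (y - x).
    by rewrite ler_wpM2r//; lra.
  have Rxy : Rm x <= Rm y by apply: nR => //; lra.
  have : (Rm y - Rm x) * (1 - a_ q) <= (Rm y - Rm x) * 1.
    by rewrite ler_wpM2l//; lra.
  lra.
move=> x y x0 xy y1.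
have hx := branch_iter_range q (x := x) ltac:(lra).
have hy := branch_iter_range q (x := y) ltac:(lra).
have e := branch_iter_expand q x0 xy y1.
have e1 := branch_iter_expand q (ltac:(lra) : 0 <= y) y1 (lexx 1).
have p0 : 0 <= 3^-1 ^+ q * (y - x) by rewrite mulr_ge0 ?exprn_ge0//; lra.
have p1 : 0 <= 3^-1 ^+ q * (1 - y) by rewrite mulr_ge0 ?exprn_ge0//; lra.
have := pushn_increment q nR x0 xy y1.
have := slope (iter q g x) (iter q g y) ltac:(lra) ltac:(lra).
rewrite -/(a_ q) in e1.
move=> /(_ ltac:(lra)) s1 s2.
have : rho / 2 * (3^-1 ^+ q * (y - x)) <=
    rho / 2 * (iter q g y - iter q g x) by rewrite ler_wpM2l//; lra.
by rewrite /c /floor_step; lra.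
Qed.

(** The part [K] that is split off depends only on [q] and [rho], not on [F]: any two
[F] that are tight in the sense of the last hypothesis end up sharing it. *)
Lemma pushn_mixing q (rho : R) : 0 < rho -> exists M K, forall F,
  concave_on 0 F -> nondecreasing_on 0 F -> F 0 = 0 -> F 1 = 1 ->
  (forall n, pushn n F (a_ q) <= rho / 2) ->
  [/\ nondecreasing_on 0 (fun x => pushn M F x - K x), nondecreasing_on 0 K,
     K 0 = 0 & 1 - K 1 <= rho].
Proof.
move=> rho0; pose c := floor_step q rho.
have c0 : 0 < c by rewrite /c /floor_step mulr_gt0 ?exprn_gt0//; lra.
have ex : exists m : nat, 1 - m%:R * c < rho.
  exists (Num.bound c^-1).
  have := archi_boundP (ltW (_ : 0 < c^-1)); rewrite invr_gt0 => /(_ c0).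
  by rewrite -(ltr_pM2r c0) mulVf ?gt_eqF//; lra.
case: (ex_minnP ex) => m hm min_m.
exists (m * q)%N, (floor_part q c m) => F cF nF F0 F1 tF.
split; [|by apply: floor_part_nondecreasing; lra|exact: floor_part0|].
  apply: (pushn_floor rho0 cF nF F0 F1 tF _).2 => i im.
  by rewrite leNgt; apply/negP => /min_m; rewrite leqNgt im.
by rewrite floor_part1; lra.
Qed.

End Operator.

(** * The left branch and the backward orbit of 1 *)
Section LeftBranch.
Context {R : realType} {alpha : R} (alpha0 : 0 < alpha) (alpha1 : alpha < 1).
Implicit Types (x y t theta : R) (n k : nat).

Definition left_map x := x * (1 + 2 `^ alpha * x `^ alpha).
Definition left_slope x := (2 * x) `^ alpha.
Local Notation w := left_slope.

Lemma left_mapE x : 0 <= x -> left_map x = x + x * w x.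
Proof. by move=> x0; rewrite /left_map /left_slope powRM//; lra. Qed.

Let w_ge0 x : 0 <= w x. Proof. exact: powR_ge0. Qed.

Let w_le x y : 0 <= x -> x <= y -> w x <= w y.
Proof.
have al0 := alpha0; have al1 := alpha1.
by move=> x0 xy; rewrite /left_slope ge0_ler_powR ?nnegrE//; lra.
Qed.

Let w_half : w 2^-1 = 1.
Proof. by rewrite /left_slope divff ?powR1. Qed.

Lemma left_map0 : left_map 0 = 0. Proof. by rewrite /left_map mul0r. Qed.

Lemma left_map_half : left_map 2^-1 = 1.
Proof. by rewrite left_mapE ?w_half; lra. Qed.

Lemma left_map_expand x y : 0 <= x -> x <= y ->
  y - x <= left_map y - left_map x.
Proof.
move=> x0 xy; rewrite !left_mapE; [|lra..].
have := w_le x0 xy; have := w_ge0 x; nra.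
Qed.

(** The function [t |-> t ^ alpha / t] is nonincreasing because [alpha < 1]. *)
Let w_star x y : 0 <= x -> x <= y -> 0 < y -> x * w y <= y * w x.
Proof.
have al0 := alpha0; have al1 := alpha1.
move=> x0 xy y0; have [->|xn0] := eqVneq x 0.
  by rewrite mul0r mulr_ge0// ltW.
have -> : w x = w y * (x / y) `^ alpha.
  rewrite /left_slope -powRM; [|lra|by rewrite divr_ge0; lra].
  by congr (_ `^ _); field; lra.
have : x / y <= (x / y) `^ alpha.
  apply: ger1_powR; last lra.
  by rewrite divr_gt0/= ?ler_pdivrMr//; lra.
rewrite ler_pdivrMr// => h; have := w_ge0 y.
by nra.
Qed.

Lemma left_map_lipschitz x y : 0 <= x -> x <= y -> y <= 2^-1 ->
  left_map y - left_map x <= 3 * (y - x).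
Proof.
move=> x0 xy y1; rewrite !left_mapE; [|lra..].
have [y0|y0] := leP y 0.
  have x00 : x = 0 by apply/eqP; rewrite eq_le; lra.
  have y00 : y = 0 by apply/eqP; rewrite eq_le; lra.
  by rewrite x00 y00; lra.
 have h := w_star x0 xy y0.
have wy : w y <= 1 by rewrite -w_half w_le//; lra.
have wy0 := w_ge0 y.
suff : y * (y * w y - x * w x) <= y * (2 * (y - x)) by rewrite ler_pM2l//; lra.
have h2 : x * (x * w y) <= x * (y * w x) by rewrite ler_wpM2l.
have h3 : w y * ((y - x) * (y + x)) <= 1 * ((y - x) * (y + x)).
  by rewrite ler_wpM2r// mulr_ge0; lra.
have h4 : 0 <= (y - x) * (y - x) by rewrite mulr_ge0; lra.
nra.
Qed.

Lemma left_map_convex x y t : 0 <= x -> 0 <= y -> 0 <= t <= 1 ->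
  left_map (t * x + (1 - t) * y) <= t * left_map x + (1 - t) * left_map y.
Proof.
have al0 := alpha0; have al1 := alpha1.
move=> x0 y0 t01.
have lE z : 0 <= z -> left_map z = z + 2 `^ alpha * z `^ (1 + alpha).
  move=> z0; rewrite /left_map mulrDr mulr1; congr (_ + _).
  have := mulr_powRB1 z0 (ltac:(lra) : 0 < 1 + alpha).
  by rewrite (_ : 1 + alpha - 1 = alpha) => [<-|]; lra.
rewrite !lE; [|nra..].
have := @convex_powR R (1 + alpha) ltac:(lra) (@Itv01 R t (proj1 (andP t01)) (proj2 (andP t01))) x y.
rewrite !inE/= !in_itv/= !andbT => /(_ x0 y0).
rewrite !convRE/= /unstable.onem => h.
have := ler_wpM2l (powR_ge0 2 alpha) h; lra.
Qed.

Lemma left_map_cancel x y : 0 <= x -> 0 <= y -> left_map x <= left_map y ->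
  x <= y.
Proof.
move=> x0 y0 h; rewrite leNgt; apply/negP => yx.
by have := left_map_expand y0 (ltW yx); lra.
Qed.

Lemma left_map_surj y : 0 <= y <= 1 ->
  exists2 x, 0 <= x <= 2^-1 & left_map x = y.
Proof.
move=> y01.
pose F x := left_map (x / 2).
have hF x z : 0 <= x -> x <= z -> z <= 1 -> 0 <= F z - F x <= 2 * (z - x).
  move=> x0 xz z1; rewrite /F.
  have := @left_map_expand (x / 2) (z / 2) ltac:(lra) ltac:(lra).
  have := @left_map_lipschitz (x / 2) (z / 2) ltac:(lra) ltac:(lra) ltac:(lra).
  lra.
have cF := continuous_subspaceT (clamp_continuous (ler0n _ 2) hF).
have [|x _ xy] := @IVT R _ 0 1 y ler01 (cF _).
  rewrite !clampE ?lexx ?ler01// /F mul0r left_map0 mul1r left_map_half.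
  by rewrite (min_idPl _)// (max_idPr _).
by exists (clamp x / 2) => //; have := clamp_range x; lra.
Qed.

Definition left_inv y := xget 0 [set x | 0 <= x <= 2^-1 /\ left_map x = y].

Lemma left_invP y : 0 <= y <= 1 ->
  0 <= left_inv y <= 2^-1 /\ left_map (left_inv y) = y.
Proof.
move=> /left_map_surj[x hx xy].
exact: (@xgetPex _ 0 [set x | 0 <= x <= 2^-1 /\ left_map x = y]
  (ex_intro _ x (conj hx xy))).
Qed.

Lemma left_invK x : 0 <= x <= 2^-1 -> left_inv (left_map x) = x.
Proof.
move=> hx.
have := @left_map_expand 0 x ltac:(lra) ltac:(lra).
have := @left_map_expand x 2^-1 ltac:(lra) ltac:(lra).
rewrite left_map_half left_map0 => h1 h2.
have [h3 h4] := @left_invP (left_map x) ltac:(lra).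
by apply/eqP; rewrite eq_le; apply/andP; split; apply: left_map_cancel;
  rewrite ?h4//; lra.
Qed.

Lemma left_inv_le x y : 0 <= x -> x <= y -> y <= 1 -> left_inv x <= left_inv y.
Proof.
move=> x0 xy y1.
have [h1 h2] := @left_invP x ltac:(lra); have [h3 h4] := @left_invP y ltac:(lra).
by apply: left_map_cancel; rewrite ?h2 ?h4//; lra.
Qed.

(** The slope of the left branch increases from 1 at 0 to [2 + alpha < 3] at 1/2. *)
Lemma left_inv_full_branch : full_branch left_inv.
Proof.
split.
- by rewrite -{1}left_map0 left_invK//; lra.
- by rewrite -[X in left_inv X]left_map_half left_invK//; lra.
- move=> x y t hx hy ht.
  have [h1 h2] := left_invP hx; have [h3 h4] := left_invP hy.
  have [h5 h6] := @left_invP (t * x + (1 - t) * y) ltac:(nra).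
  apply: left_map_cancel; [nra|lra|].
  by rewrite h6 -{2}h2 -{2}h4; apply: left_map_convex; lra.
- move=> x y x0 xy y1.
  have := left_inv_le x0 xy y1.
  have [h1 h2] := @left_invP x ltac:(lra); have [h3 h4] := @left_invP y ltac:(lra).
  move=> h; have := left_map_lipschitz (proj1 (andP h1)) h (proj2 (andP h3)).
  lra.
- move=> x y x0 xy y1.
  have := left_inv_le x0 xy y1.
  have [h1 h2] := @left_invP x ltac:(lra); have [h3 h4] := @left_invP y ltac:(lra).
  move=> h; have := left_map_expand (proj1 (andP h1)) h.
  lra.
- move=> u u0 u1; exists (left_map u); last by rewrite left_invK//; lra.
  have := @left_map_expand 0 u ltac:(lra) ltac:(lra).
  have := @left_map_expand u 2^-1 ltac:(lra) ltac:(lra).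
  rewrite left_map_half left_map0; lra.
Qed.

Local Notation a := (@a_ R left_inv).
Let gP := left_inv_full_branch.

Lemma aS_map n : a n = a n.+1 + a n.+1 * (2 * a n.+1) `^ alpha.
Proof.
have [h1 h2] := left_invP (a_range gP n).
by rewrite -[LHS]h2 left_mapE ?aS//; lra.
Qed.

Lemma a_le_half n : a n.+1 <= 2^-1.
Proof. by rewrite aS (branch_le_half gP)// (a_range gP). Qed.

Lemma a_le_double n : a n <= 2 * a n.+1.
Proof.
rewrite aS_map.
have := a_range gP n.+1; have := a_le_half n.
have : w (a n.+1) <= 1.
  by rewrite -w_half w_le//; [have := a_range gP n.+1; lra|exact: a_le_half].
rewrite -/(w _); have := w_ge0 (a n.+1); nra.
Qed.

Lemma a_gt0 n : 0 < a n.
Proof.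
elim: n => [|n ih]; first exact: ltr01.
by have := a_le_double n; lra.
Qed.

Lemma a_nonincr n k : (n <= k)%N -> a k <= a n.
Proof.
move=> /subnK <-; elim: (k - n)%N => // j ih; apply: le_trans ih.
rewrite addSn [leRHS]aS_map lerDl mulr_ge0 ?powR_ge0//.
exact/ltW/a_gt0.
Qed.

Let powR_1D (e x : R) : 0 < e -> 0 <= x <= 1 -> 1 + e / 2 * x <= (1 + x) `^ e.
Proof.
have al0 := alpha0; have al1 := alpha1.
move=> e0 hx; rewrite /powR gt_eqF; last lra.
have h : x / 2 <= ln (1 + x).
  rewrite -ler_expR lnK ?posrE; last lra.
  have := expR_ge1Dx (- (x / 2)); rewrite expRN => h.
  have p := expR_gt0 (x / 2).
  have : (1 - x / 2) * expR (x / 2) <= 1.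
    by rewrite -ler_pdivlMr// mul1r; lra.
  suff : (1 - x / 2) * (1 + x) >= 1 by nra.
  nra.
apply: (le_trans _ (expR_ge1Dx _)).
by rewrite lerD2l -mulrA ler_pM2l// mulrC.
Qed.

(** From [a n = a n.+1 * (1 + (2 a n.+1) ^ alpha)] the increments of [a ^ e], with
[e = theta - alpha], dominate a multiple of [a n.+1 ^ theta], and they
telescope. *)
Lemma sum_a_bounded theta : alpha < theta -> exists2 C, 0 <= C &
  forall n, \sum_(0 <= k < n) a k `^ theta <= C.
Proof.
have al0 := alpha0; have al1 := alpha1.
move=> hth; pose e := theta - alpha.
have e0 : 0 < e by rewrite /e; lra.
have step n : e / 2 * a n.+1 `^ theta <= a n `^ e - a n.+1 `^ e.
  have p := a_gt0 n.+1; have ww : 0 <= w (a n.+1) <= 1.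
    by rewrite w_ge0 -w_half w_le//; [exact: ltW|exact: a_le_half].
  have -> : a n `^ e = a n.+1 `^ e * (1 + w (a n.+1)) `^ e.
    by rewrite aS_map -powRM ?ltW// -/(w _); [congr (_ `^ _); lra|lra].
  have -> : a n.+1 `^ theta = a n.+1 `^ e * a n.+1 `^ alpha.
    rewrite -powRD; first by rewrite /e subrK.
    by apply/implyP => _; rewrite gt_eqF.
  have := powR_1D e0 ww.
  have : a n.+1 `^ alpha <= w (a n.+1).
    by rewrite /left_slope ge0_ler_powR ?nnegrE ?ltW//; lra.
  have := powR_gt0 e p => q1 q2 q3.
  have : a n.+1 `^ e * (1 + e / 2 * w (a n.+1)) <=
    a n.+1 `^ e * (1 + w (a n.+1)) `^ e by rewrite ler_pM2l.
  have : e / 2 * (a n.+1 `^ e * a n.+1 `^ alpha) <=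
    e / 2 * (a n.+1 `^ e * w (a n.+1)) by rewrite !ler_pM2l//; lra.
  lra.
exists (1 + 2 / e); first by rewrite addr_ge0// divr_ge0//; lra.
case=> [|n].
  by rewrite big_nil addr_ge0// divr_ge0//; lra.
rewrite big_nat_recl//= powR1 lerD2l -(@ler_pM2l _ (e / 2)); last lra.
have -> : e / 2 * (2 / e) = 1 by field; lra.
suff : e / 2 * \sum_(0 <= i < n) a i.+1 `^ theta <= 1 - a n `^ e.
  by have := powR_ge0 (a n) e; lra.
elim: n => [|n ih]; first by rewrite big_nil mulr0 /a_/= powR1 subrr.
by rewrite big_nat_recr//= mulrDr; have := step n; lra.
Qed.

Lemma mul_a_bounded theta : alpha < theta -> exists2 C, 0 <= C &
  forall n, n%:R * a n `^ theta <= C.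
Proof.
have al0 := alpha0; have al1 := alpha1.
move=> hth; have [C C0 hC] := sum_a_bounded hth; exists C => // n.
apply: le_trans (hC n); rewrite mulr_natl -[X in _ *+ X]subn0 -sumr_const_nat.
apply: ler_sum_nat => i /andP[_ ni].
rewrite ge0_ler_powR ?nnegrE ?(ltW (a_gt0 _))//; last exact/a_nonincr/ltnW.
lra.
Qed.

Lemma a_small (e : R) : 0 < e -> exists n, a n <= e.
Proof.
move=> e0; have [C C0 hC] := mul_a_bounded alpha1.
exists (Num.bound (C / e)); set n := Num.bound _.
have Cn : C / e < n%:R by apply: archi_boundP; rewrite divr_ge0// ltW.
have n0 : 0 < n%:R :> R by apply: le_lt_trans Cn; rewrite divr_ge0// ltW.
have := hC n; rewrite powRr1 ?(ltW (a_gt0 _))// => h.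
rewrite -(ler_pM2l n0); apply: (le_trans h).
by rewrite -ler_pdivrMr// ltW.
Qed.

Lemma powR_a_small (p e : R) : 0 < p -> 0 < e -> exists n, a n `^ p <= e.
Proof.
move=> p0 e0; have [n hn] := a_small (powR_gt0 p^-1 e0); exists n.
have -> : e = (e `^ p^-1) `^ p by rewrite -powRrM mulVf ?powRr1 ?ltW// gt_eqF.
by rewrite ge0_ler_powR ?nnegrE ?powR_ge0// ltW// a_gt0.
Qed.

(** Take the last [k] with [2 r <= a k ^ theta].  Then [a k] is comparable to
[a k.+1], which is at most a small factor [a k.+1 ^ (1 - theta)] times [2 r].
With an intermediate exponent [th'], [k * a k ^ th'] is bounded, so [k r] is at
most a constant times [a k ^ (theta - th')]. *)
Lemma time_scale theta (e : R) K0 : alpha < theta -> theta < 1 -> 0 < e ->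
  exists2 r0, 0 < r0 & forall r, 0 < r -> r < r0 -> exists k,
    [/\ (K0 <= k)%N, a k <= e * r, 2 * r <= a k `^ theta & k%:R * r <= e].
Proof.
have al0 := alpha0; have al1 := alpha1.
move=> hth th1 e0.
pose th' := (alpha + theta) / 2.
have [C C0 hC] := @mul_a_bounded th' ltac:(rewrite /th'; lra).
have [n1 hn1] := @powR_a_small (1 - theta) (e / 4) ltac:(lra) ltac:(lra).
have [n2 hn2] := @powR_a_small (theta - th') (e / (C + 1)) ltac:(rewrite /th'; lra)
  (divr_gt0 e0 (ltac:(lra) : 0 < C + 1)).
have powle p k n : 0 < p -> (n <= k)%N -> a k `^ p <= a n `^ p.
  move=> p0 nk; rewrite ge0_ler_powR ?nnegrE ?(ltW (a_gt0 _)) ?(ltW p0)//.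
  exact: a_nonincr.
pose K1 := maxn K0 (maxn n1 n2).
exists (a K1 `^ theta / 2); first by rewrite divr_gt0 ?powR_gt0 ?a_gt0.
move=> r r0 rr0.
have ex : exists n, a n `^ theta < 2 * r.
  have [n hn] := @powR_a_small theta r ltac:(lra) r0; exists n; lra.
case: (ex_minnP ex) => n hn min_n.
have K1n : (K1 < n)%N.
  rewrite ltnNge; apply/negP => nK.
  have := powle theta _ _ ltac:(lra) nK; lra.
case: n hn min_n K1n => // k hk min_k; rewrite ltnS => K1k.
have [K0k n1k n2k] : [/\ (K0 <= k)%N, (n1 <= k)%N & (n2 <= k)%N].
  by move: K1k; rewrite !geq_max => /and3P[].
have rk : 2 * r <= a k `^ theta.
  by rewrite leNgt; apply/negP => /min_k; rewrite ltnn.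
have split_pow p q n : a n `^ (p + q) = a n `^ p * a n `^ q.
  by rewrite powRD//; apply/implyP => _; rewrite gt_eqF// a_gt0.
exists k; split => //.
  apply: (le_trans (a_le_double _)).
  rewrite -[X in 2 * X]powRr1 ?(ltW (a_gt0 _))// (_ : 1 = theta + (1 - theta)); last lra.
  rewrite split_pow.
  have h := le_trans (powle (1 - theta) k.+1 n1 ltac:(lra) (leqW n1k)) hn1.
  have : a k.+1 `^ theta * a k.+1 `^ (1 - theta) <= 2 * r * (e / 4).
    by rewrite ler_pM ?powR_ge0// ltW.
  lra.
have th'E : theta = th' + (theta - th') by lra.
have : k%:R * (2 * r) <= k%:R * a k `^ th' * a k `^ (theta - th').
  by rewrite -mulrA -split_pow -th'E ler_wpM2l.
have h := le_trans (powle (theta - th') k n2 ltac:(rewrite /th'; lra) n2k) hn2.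
have : k%:R * a k `^ th' * a k `^ (theta - th') <= C * (e / (C + 1)).
  by rewrite ler_pM ?mulr_ge0 ?powR_ge0.
have : C * (e / (C + 1)) <= e.
  by rewrite mulrCA ger_pMr// ler_pdivrMr; lra.
lra.
Qed.

End LeftBranch.

(** * Return times of a set that mixes *)
Section FineMeasure.
Context {d : measure_display} {X : measurableType d} {R : realType}.
Variable m : {finite_measure set X -> \bar R}.
Implicit Types A B : set X.

Lemma fine_measure_ge0 A : 0 <= fine (m A).
Proof. exact/fine_ge0/measure_ge0. Qed.

Lemma fine_measure_le A B : measurable A -> measurable B -> A `<=` B ->
  fine (m A) <= fine (m B).
Proof.
by move=> mA mB AB; rewrite fine_le ?fin_num_measure// le_measure// inE.
Qed.

Lemma fine_measure_split A B : measurable A -> measurable B ->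
  fine (m A) = fine (m (A `&` B)) + fine (m (A `\` B)).
Proof.
move=> mA mB; have mI := measurableI _ _ mA mB; have mD := measurableD mA mB.
by rewrite -fineD ?fin_num_measure// addeC -(measureDI _ mA mB).
Qed.

Lemma fine_measure_cover A B C : measurable A -> measurable B ->
  measurable C -> C `<=` A `|` B -> fine (m C) <= fine (m A) + fine (m B).
Proof.
move=> mA mB mC CAB; rewrite (fine_measure_split mC mA) lerD//.
  by apply: fine_measure_le => //; exact: measurableI.
apply: fine_measure_le => //; first exact: measurableD.
by move=> x [/CAB[]].
Qed.

Lemma fine_measureU A B : measurable A -> measurable B -> A `&` B = set0 ->
  fine (m (A `|` B)) = fine (m A) + fine (m B).
Proof. by move=> mA mB AB; rewrite measureU// fineD// fin_num_measure. Qed.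

End FineMeasure.

Section ReturnTimes.
Context {R : realType}.
Local Notation X := (measurableTypeR R).
Variables (mu : probability X R) (T : R -> R) (U : set R).
Hypothesis mT : measurable_fun [set: X] (T : X -> X).
Hypothesis invT : invariant_measure T mu.
Hypothesis mU : measurable (U : set X).
Local Notation p A := (fine (mu A)).
Local Notation m := (fine (mu U)).

Let invX (A : set R) : measurable (A : set X) -> mu (T @^-1` A) = mu A.
Proof. exact: invT. Qed.

Definition avoids n : set R :=
  [set x | forall j, (1 <= j <= n)%N -> ~ U (iter j T x)].

Lemma measurable_preimage_map (A : set R) :
  measurable (A : set X) -> measurable (T @^-1` A : set X).
Proof. by move=> mA; rewrite -[_ @^-1` _]setTI; exact: mT. Qed.

Lemma measurable_preimage_iter n (A : set R) :
  measurable (A : set X) -> measurable (iter n T @^-1` A : set X).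
Proof.
elim: n A => //= n ih A mA.
rewrite (_ : _ @^-1` _ = iter n T @^-1` (T @^-1` A)) //.
by apply: ih; exact: measurable_preimage_map.
Qed.

Lemma measure_preimage_iter n (A : set R) :
  measurable (A : set X) -> mu (iter n T @^-1` A) = mu A.
Proof.
elim: n A => //= n ih A mA.
rewrite (_ : _ @^-1` _ = iter n T @^-1` (T @^-1` A)) //.
by rewrite ih ?invX//; exact: measurable_preimage_map.
Qed.

Lemma avoidsS n : avoids n.+1 = T @^-1` (~` U `&` avoids n).
Proof.
apply/seteqP; split=> x /=.
  move=> h; split; first exact: (h 1%N).
  by move=> j hj; rewrite /= -iterSr; apply: h; lia.
move=> [h1 h2] [//|[|j]] hj; first exact: h1.
by rewrite iterSr; apply: h2; lia.
Qed.

Lemma avoids_split N n : avoids (N + n) = avoids N `&` iter N T @^-1` avoids n.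
Proof.
apply/seteqP; split=> x /=.
  move=> h; split=> j hj; first by apply: h; lia.
  by rewrite -iterD; apply: h; lia.
move=> [h1 h2] j hj; have [jN|Nj] := leqP j N; first by apply: h1; lia.
by rewrite -(subnK (ltnW Nj)) iterD; apply: h2; lia.
Qed.

Lemma measurable_avoids n : measurable (avoids n : set X).
Proof.
elim: n => [|n ih].
  rewrite (_ : avoids 0 = setT) //; apply/seteqP; split=> // x _ [|j]//.
rewrite avoidsS; apply: measurable_preimage_map.
by apply: measurableI => //; exact: measurableC.
Qed.

Let mQ := measurable_avoids.


(** By invariance [avoids n.+1] has the measure of [avoids n] outside [U]. *)
Lemma avoids_decrease n : p (avoids n) - p (avoids n.+1) = p (U `&` avoids n).
Proof.
rewrite avoidsS invX; last by apply: measurableI => //; exact: measurableC.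
rewrite (fine_measure_split _ (mQ n) mU) [U `&` _]setIC [~` U `&` _]setIC.
by rewrite -setDE; lra.
Qed.

Lemma avoids_early N : 1 - p (avoids N) <= N%:R * m.
Proof.
elim: N => [|N ih].
  rewrite (_ : avoids 0 = setT) ?probability_setT ?mul0r ?subrr//.
  by apply/seteqP; split=> // x _ [|j].
have := avoids_decrease N.
have : p (U `&` avoids N) <= m.
  by apply: fine_measure_le => //; exact: measurableI.
by rewrite -[N.+1]addn1 natrD; lra.
Qed.

Let fineC (A : set R) : measurable (A : set X) -> p (~` A) = 1 - p A.
Proof.
move=> mA; have := fine_measure_split mu (measurableT : measurable [set: X]) mA.
by rewrite setTI setTD -/(mu setT) /= probability_setT/=; lra.
Qed.

Let fine_le1 (A : set R) : measurable (A : set X) -> p A <= 1.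
Proof. by move=> mA; have := fineC mA; have := fine_measure_ge0 mu (~` A); lra. Qed.

(** The first [N] times are disregarded: in [U] because few points return so early, in
the whole space because a visit to [U] in [N] steps has probability at most
[N * m].  What remains is an event that depends on [T^N x] only. *)
Lemma avoids_decorrelation (e1 e2 : R) N n : 0 < m ->
  p (U `\` avoids N) <= e1 * m ->
  (forall V : set R, measurable (V : set X) ->
    `|p (U `&` iter N T @^-1` V) - m * p V| <= e2 * m) ->
  `|p (U `&` avoids n) - m * p (avoids n)| <= (e1 + e2 + N%:R * m) * m.
Proof.
move=> m0 he1 he2.
have e10 : 0 <= e1.
  by rewrite -(pmulr_lge0 _ m0); apply: le_trans he1; exact: fine_measure_ge0.
have mI k : measurable (U `&` avoids k : set X) by exact: measurableI.
have early := avoids_early N.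
have [Nn|nN] := leqP N n; last first.
  have e20 : 0 <= e2.
    rewrite -(pmulr_lge0 _ m0); apply: le_trans (he2 set0 _) => //.
  have sub : avoids N `<=` avoids n by move=> x h j hj; apply: h; lia.
  have h1 : p (avoids N) <= p (avoids n) by exact: fine_measure_le.
  have h2 : p (U `\` avoids n) <= p (U `\` avoids N).
    by apply: fine_measure_le; [exact: measurableD..|move=> x [? ?]; split; auto].
  have h3 := fine_measure_split mu mU (mQ n).
  have h4 := fine_le1 (mQ n).
  have h5 := fine_measure_ge0 mu (U `\` avoids n).
  have h6 : m * (1 - p (avoids n)) <= m * (N%:R * m).
    by rewrite ler_wpM2l//; lra.
  have h7 : 0 <= m * (1 - p (avoids n)) by rewrite mulr_ge0//; lra.
  have h8 : 0 <= e2 * m by rewrite mulr_ge0// ltW.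
  rewrite ler_norml; apply/andP; split; nra.
rewrite -(subnKC Nn) avoids_split; set V := avoids (n - N).
have mV := mQ (n - N).
have mTV := measurable_preimage_iter N mV.
have /ler_normlP[h1 h1'] := he2 V mV.
have hV : p V = p (iter N T @^-1` V) by rewrite measure_preimage_iter.
have h2 := fine_measure_split mu (measurableI _ _ mU mTV) (mQ N).
have h3 := fine_measure_split mu mTV (mQ N).
have h4 : p ((U `&` iter N T @^-1` V) `\` avoids N) <= e1 * m.
  apply: le_trans he1; apply: fine_measure_le; [|exact: measurableD|].
    by apply: measurableD => //; exact: measurableI.
  by move=> x [[? ?] ?].
have h5 : p (iter N T @^-1` V `\` avoids N) <= N%:R * m.
  apply: (@le_trans _ _ (p (~` avoids N))); last by rewrite fineC.
  apply: fine_measure_le; [exact: measurableD|exact: measurableC|].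
  by move=> x [].
have h6 := fine_measure_ge0 mu ((U `&` iter N T @^-1` V) `\` avoids N).
have h7 := fine_measure_ge0 mu (iter N T @^-1` V `\` avoids N).
have h8 : m * p (iter N T @^-1` V `\` avoids N) <= m * (N%:R * m).
  by rewrite ler_wpM2l// ltW.
have h9 : 0 <= m * p (iter N T @^-1` V `\` avoids N) by rewrite mulr_ge0// ltW.
have -> : U `&` (avoids N `&` iter N T @^-1` V) =
  (U `&` iter N T @^-1` V) `&` avoids N by rewrite setIA setIAC.
rewrite [avoids N `&` _]setIC.
have h10 : 0 <= e1 * m by rewrite mulr_ge0// ltW.
by rewrite ler_norml; apply/andP; split; rewrite h3 in hV; nra.
Qed.

Lemma expR_step (x : R) : 0 <= x <= 1 ->
  0 <= expR (- x) - (1 - x) <= x * x.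
Proof.
move=> hx; have := expR_ge1Dx (- x) => h1; rewrite subr_ge0 h1 /=.
have h2 := expR_ge1Dx x; have h3 := expR_gt0 x.
have : expR (- x) * (1 + x) <= 1.
  by rewrite expRN mulrC ler_pdivrMr// mul1r.
have h4 := expR_gt0 (- x); nra.
Qed.

(** The recursion [p n.+1 = p n - mu (U `&` avoids n)], with an error [dl * m] in each
step, is compared with [exp (- m) ^ n].  The errors do not add up to more
than [dl + m], because each step also contracts the difference by [1 - m]. *)
Lemma return_time_exponential (dl : R) : 0 < m ->
  (forall n, `|p (U `&` avoids n) - m * p (avoids n)| <= dl * m) ->
  return_time_error T mu U <= 2 * dl + 2 * m.
Proof.
move=> m0 hdl.
have m1 : m <= 1 := fine_le1 mU.
have dl0 : 0 <= dl by rewrite -(pmulr_lge0 _ m0); apply: le_trans (hdl 0%N).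
have em := expR_step (ltac:(lra) : 0 <= m <= 1).
have exp01 n : 0 <= expR (- (n%:R * m)) <= 1.
  rewrite expR_ge0 -[leRHS]expR0 ler_expR oppr_le0 mulr_ge0//; lra.
have key n : `|p (avoids n) - expR (- (n%:R * m))| <= dl + m.
  elim: n => [|n ih].
    rewrite mul0r oppr0 expR0 (_ : avoids 0 = setT).
      rewrite probability_setT/= subrr normr0; lra.
    by apply/seteqP; split=> // x _ [|j].
  have expS : expR (- (n.+1%:R * m)) = expR (- m) * expR (- (n%:R * m)).
    by rewrite -expRD -[n.+1]addn1 natrD; congr expR; lra.
  have := avoids_decrease n => dec.
  have /ler_normlP[d1 d2] := hdl n.
  have /ler_normlP[i1 i2] := ih.
  have ex := exp01 n.
  rewrite expS ler_norml.
  set E := expR (- (n%:R * m)) in ex i1 i2 *.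
  set e := expR (- m) in em *.
  have f1 : (1 - m) * (p (avoids n) - E) <= (1 - m) * (dl + m).
    by rewrite ler_wpM2l//; lra.
  have f2 : (1 - m) * (E - p (avoids n)) <= (1 - m) * (dl + m).
    by rewrite ler_wpM2l//; lra.
  have f3 : 0 <= (e - (1 - m)) * E by rewrite mulr_ge0//; lra.
  have f4 : (e - (1 - m)) * E <= (e - (1 - m)) * 1 by rewrite ler_wpM2l//; lra.
  apply/andP; split; nra.
apply: ge_sup; first by exists `|cond_prob mu U
    [set x | U x /\ ((0 / m)%:E < return_time T U x)%E] - expR (- 0)|, 0 => /=.
move=> _ [t /= t0 <-].
pose n := Num.truncn (t / m).
have tm0 : 0 <= t / m by rewrite divr_ge0// ltW.
have /andP[nle nlt] := truncn_itv tm0.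
(* The return time is an integer, so it exceeds [t / m] iff it exceeds [n]. *)
have setE : [set x | U x /\ ((t / m)%:E < return_time T U x)%E] = U `&` avoids n.
  apply/seteqP; split=> x [Ux hx]; split=> //.
    move=> j /andP[j1 jn] Uj; move: hx; rewrite ltNge => /negP; apply.
    apply: (@le_trans _ _ (j%:R)%:E); first by apply: ereal_inf_lbound; exists j.
    by rewrite lee_fin (le_trans _ nle)// ler_nat.
  apply: (@lt_le_trans _ _ (n.+1%:R)%:E); first by rewrite lte_fin.
  apply: le_ereal_inf_tmp => _ [j [j1 Uj] <-]; rewrite lee_fin ler_nat ltnNge.
  by apply/negP => jn; apply: (hx j) => //; rewrite j1.
rewrite /cond_prob setE.
rewrite -/n in nle nlt.
have -> : U `&` avoids n `&` U = U `&` avoids n by rewrite setIAC setIid.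
have g1 : `|p (U `&` avoids n) / m - p (avoids n)| <= dl.
  have -> : p (U `&` avoids n) / m - p (avoids n) =
      (p (U `&` avoids n) - m * p (avoids n)) / m by field; rewrite gt_eqF.
  by rewrite normrM normfV (gtr0_norm m0) ler_pdivrMr.
have g2 := key n.
have g3 : `|expR (- (n%:R * m)) - expR (- t)| <= m.
  have h1 : n%:R * m <= t by rewrite -ler_pdivlMr.
  have h2 : t - n%:R * m <= m.
    by move: nlt; rewrite ltr_pdivrMr// -[n.+1]addn1 natrD; lra.
  have -> : - t = - (t - n%:R * m) + - (n%:R * m) by lra.
  rewrite expRD.
  have := expR_ge1Dx (- (t - n%:R * m)).
  have : expR (- (t - n%:R * m)) <= 1 by rewrite -[leRHS]expR0 ler_expR; lra.
  have := exp01 n.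
  set E := expR (- (n%:R * m)); set F := expR _ => q1 q2 q3.
  by rewrite ler_norml; apply/andP; split; nra.
move: g1 g2 g3 => /ler_normlP[? ?] /ler_normlP[? ?] /ler_normlP[? ?].
by rewrite ler_norml; apply/andP; split; lra.
Qed.

End ReturnTimes.

(** * Total variation from distribution functions *)
Section Stieltjes.
Context {R : realType}.
Local Notation X := (measurableTypeR R).
Local Notation ls := lebesgue_stieltjes_measure.
Implicit Types (F K : R -> R) (nu : {finite_measure set X -> \bar R}).

Lemma lebesgue_stieltjes_itv (f : cumulative R R) (a b : R) : a <= b ->
  ls f `]a, b]%classic = (f b - f a)%:E.
Proof.
move=> ab; rewrite /lebesgue_stieltjes_measure /measure_extension/=.
by rewrite measurable_mu_extE/= ?wlength_itv_bnd//; exact: is_ocitv.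
Qed.

(** Intervals [[0, x[] are taken half-open because the preimage of such an interval
under the map consists of intervals of the form [[c, b[]. *)
Definition left_cdf nu F := forall x, 0 <= x <= 1 -> F x = fine (nu `[0, x[%classic).

Definition carried_by_unit nu := nu (~` `[0, 1[%classic) = 0%E.

Lemma carried_by_unitE nu (A : set X) : carried_by_unit nu -> measurable A ->
  fine (nu A) = fine (nu (A `&` `[0, 1[%classic)).
Proof.
move=> cnu mA; have mI : measurable (`[0, 1[%classic : set X) by exact: measurable_itv.
rewrite (fine_measure_split nu mA mI).
have : fine (nu (A `\` `[0, 1[%classic)) <= fine (nu (~` `[0, 1[%classic)).
  apply: fine_measure_le; [exact: measurableD|exact: measurableC|].
  by move=> x [].
have := fine_measure_ge0 nu (A `\` `[0, 1[%classic); rewrite cnu/=; lra.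
Qed.

Lemma left_cdf_itv nu F a b : left_cdf nu F -> 0 <= a -> a <= b -> b <= 1 ->
  fine (nu `[a, b[%classic) = F b - F a.
Proof.
move=> hF a0 ab b1; rewrite !hF; [|lra..].
have -> : `[0, b[%classic = `[0, a[%classic `|` `[a, b[%classic :> set X.
  by rewrite -itv_bndbnd_setU// bnd_simp.
rewrite fine_measureU//; [lra|exact: measurable_itv..|].
apply/seteqP; split=> // x [] /=; rewrite !in_itv/=; lra.
Qed.

(** A Lipschitz distribution function excludes atoms, so the choice of the end points
does not matter; the form [`]a, b]] is the one that characterizes
Lebesgue-Stieltjes measures. *)
Lemma left_cdf_itv_oc nu F (L a b : R) : carried_by_unit nu -> left_cdf nu F ->
  0 <= L -> (forall x y, 0 <= x -> x <= y -> y <= 1 -> F y - F x <= L * (y - x)) ->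
  a <= b -> nu `]a, b]%classic = (F (clamp b) - F (clamp a))%:E.
Proof.
move=> cnu hF L0 lF ab.
have mitv (i : interval R) : measurable ([set` i] : set X) by exact: measurable_itv.
have m1 x : measurable ([set x] : set X) by exact: measurable_set1.
have null x : fine (nu [set x]) = 0.
  rewrite (carried_by_unitE cnu)//.
  have [x01|x01] := boolP (0 <= x < 1); last first.
    rewrite (_ : _ `&` _ = set0) ?measure0//.
    apply/seteqP; split=> // y [] -> /=; rewrite in_itv/=; exact/negP.
  rewrite (_ : _ `&` _ = [set x]); last first.
    apply/seteqP; split=> [y []//|y /= ->]; split => //=; rewrite in_itv/=.
  apply/eqP; rewrite eq_le fine_measure_ge0 andbT; apply/ler_addgt0Pr => e e0.
  rewrite add0r; pose y := Num.min 1 (x + e / (L + 1)).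
  have e1 : 0 < e / (L + 1) by rewrite divr_gt0//; lra.
  have xy : x < y by rewrite /y lt_min; lra.
  have y1 : y <= 1 by rewrite /y ge_min lexx.
  have yx : y - x <= e / (L + 1).
    have : y <= x + e / (L + 1) by rewrite /y ge_min lexx orbT.
    lra.
  apply: (@le_trans _ _ (fine (nu `[x, y[%classic))).
    apply: fine_measure_le => // z /= ->; rewrite in_itv/=; lra.
  rewrite (left_cdf_itv hF); [|lra..].
  have h : L * (y - x) <= L * (e / (L + 1)) by rewrite ler_wpM2l.
  have : L * (e / (L + 1)) <= e.
    by rewrite mulrCA ger_pMr// ler_pdivrMr; lra.
  have := lF x y; move=> /(_ ltac:(lra) ltac:(lra) ltac:(lra)); lra.
have clamp01 := (@clamp_range R).
have ab' := clamp_nondecreasing ab.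
rewrite -(left_cdf_itv hF); [|by have := clamp01 a; lra|lra|by have := clamp01 b; lra].
have clampP (x : R) : clamp x = x \/ (x < 0 /\ clamp x = 0) \/ (1 < x /\ clamp x = 1).
  have [|] := leP 0 x; have [|] := leP x 1 => h1 h2.
  - by left; rewrite clampE//; lra.
  - by right; right; split=> //; rewrite /clamp (min_idPl _)// ?(max_idPr _)//; lra.
  - by right; left; split=> //; rewrite /clamp (min_idPr _)// ?(max_idPl _)//; lra.
  - by exfalso; lra.
have fE A : measurable (A : set X) -> nu A = (fine (nu A))%:E.
  by move=> mA; rewrite fineK// fin_num_measure.
rewrite fE//; congr _%:E; rewrite (carried_by_unitE cnu)//.
apply/eqP; rewrite eq_le; apply/andP; split.
  rewrite -[leRHS]addr0 -[X in _ <= _ + X](null b); apply: fine_measure_cover => //.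
    exact: measurableI.
  move=> x [] /=; rewrite !in_itv/= => /andP[ax xb] /andP[x0 x1].
  have [->|xb'] := eqVneq x b; [by right|left].
  have xb2 : x < b by rewrite lt_neqAle xb'.
  by rewrite /= ?in_itv/=; have := clampP a; have := clampP b; lra.
rewrite -[leRHS]addr0 -[X in _ <= _ + X](null (clamp a)); apply: fine_measure_cover => //.
  exact: measurableI.
move=> x /=; rewrite !in_itv/= => /andP[ax xb].
have [->|xa] := eqVneq x (clamp a); [by right|left].
have xa2 : clamp a < x by rewrite lt_neqAle eq_sym xa.
have := clampP a; have := clampP b; have := clamp01 a; have := clamp01 b.
by split; rewrite /= ?in_itv/=; lra.
Qed.

(** If [k], [r1], [r2] are the measures with distribution functions [K], [F1 - K],
[F2 - K], then [nu1 = k + r1] and [nu2 = k + r2], where [r1] and [r2] have mass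
at most [rho].  Since [K] alone is only known to be monotone, this is used in
the form [nu1 + r2 = nu2 + r1], where both sides have the distribution
function [F1 + F2 - K]. *)
Lemma common_part_bound nu1 nu2 F1 F2 K (L rho : R) (V : set X) :
  carried_by_unit nu1 -> carried_by_unit nu2 ->
  left_cdf nu1 F1 -> left_cdf nu2 F2 ->
  0 <= L -> (forall x y, 0 <= x -> x <= y -> y <= 1 ->
    F1 y - F1 x <= L * (y - x) /\ F2 y - F2 x <= L * (y - x)) ->
  nondecreasing_on 0 K ->
  nondecreasing_on 0 (fun x => F1 x - K x) ->
  nondecreasing_on 0 (fun x => F2 x - K x) ->
  (F1 1 - K 1) - (F1 0 - K 0) <= rho ->
  (F2 1 - K 1) - (F2 0 - K 0) <= rho ->
  measurable V -> `|fine (nu1 V) - fine (nu2 V)| <= rho.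
Proof.
move=> c1 c2 hF1 hF2 L0 lip nK n1 n2 h1 h2 mV.
have clamp01 := (@clamp_range R).
have hcum H : (forall x y, 0 <= x -> x <= y -> y <= 1 ->
    0 <= H y - H x <= 2 * L * (y - x)) ->
    {f : cumulative R R | forall x, f x = H (clamp x)}.
  move=> hH; pose h x := H (clamp x).
  have ndh : nondecreasing h.
    move=> x y /clamp_nondecreasing xy; rewrite /h -subr_ge0.
    have := clamp01 x; have := clamp01 y => p q.
    by have /andP[] := hH (clamp x) (clamp y) ltac:(lra) xy ltac:(lra).
  have rch : right_continuous h.
    by apply: right_continuousW; apply: (@clamp_continuous _ _ (2 * L)) => //; lra.
  pose f : cumulative R R := HB.pack h (isCumulative.Build R _ R h ndh rch).
  by exists f.
have lipP x y : 0 <= x -> x <= y -> y <= 1 -> [/\ F1 x - K x <= F1 y - K y,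
    F2 x - K x <= F2 y - K y, K x <= K y, F1 y - F1 x <= L * (y - x)
    & F2 y - F2 x <= L * (y - x)].
  move=> x0 xy y1; have [p q] := lip _ _ x0 xy y1.
  by split; [exact: (n1 x y)|exact: (n2 x y)|exact: nK|..].
have [f1 f1E] := hcum (fun x => F1 x - K x) ltac:(move=> x y x0 xy y1;
  have [? ? ? ? ?] := lipP _ _ x0 xy y1; lra).
have [f2 f2E] := hcum (fun x => F2 x - K x) ltac:(move=> x y x0 xy y1;
  have [? ? ? ? ?] := lipP _ _ x0 xy y1; lra).
have [f fE] := hcum (fun x => F1 x + F2 x - K x) ltac:(move=> x y x0 xy y1;
  have [? ? ? ? ?] := lipP _ _ x0 xy y1; lra).
have e1 A : measurable (A : set X) -> ls f A = (nu1 A + ls f2 A)%E.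
  rewrite -[RHS](measure_addE nu1 (ls f2)).
  move: A; apply: (@lebesgue_stieltjes_measure_unique _ f (measure_add nu1 (ls f2))).
  move=> _ [[a b] _ <-]; rewrite [RHS]measure_addE [(a, b).1]/= [(a, b).2]/=.
  have [ab|ba] := leP a b; last first.
    by rewrite set_itv_ge ?measure0 ?adde0// bnd_simp -leNgt ltW.
  transitivity ((F1 (clamp b) - F1 (clamp a))%:E + (f2 b - f2 a)%:E)%E.
    by rewrite lebesgue_stieltjes_itv// -EFinD; congr _%:E; rewrite !fE !f2E; lra.
  congr (_ + _)%E; last exact/esym/lebesgue_stieltjes_itv.
  apply/esym/(left_cdf_itv_oc c1 hF1 L0) => // x y x0 xy y1.
  by have [] := lip _ _ x0 xy y1.
have e2 A : measurable (A : set X) -> ls f A = (nu2 A + ls f1 A)%E.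
  rewrite -[RHS](measure_addE nu2 (ls f1)).
  move: A; apply: (@lebesgue_stieltjes_measure_unique _ f (measure_add nu2 (ls f1))).
  move=> _ [[a b] _ <-]; rewrite [RHS]measure_addE [(a, b).1]/= [(a, b).2]/=.
  have [ab|ba] := leP a b; last first.
    by rewrite set_itv_ge ?measure0 ?adde0// bnd_simp -leNgt ltW.
  transitivity ((F2 (clamp b) - F2 (clamp a))%:E + (f1 b - f1 a)%:E)%E.
    by rewrite lebesgue_stieltjes_itv// -EFinD; congr _%:E; rewrite !fE !f1E; lra.
  congr (_ + _)%E; last exact/esym/lebesgue_stieltjes_itv.
  apply/esym/(left_cdf_itv_oc c2 hF2 L0) => // x y x0 xy y1.
  by have [] := lip _ _ x0 xy y1.
have mI : measurable (`[0, 1[%classic : set X) by exact: measurable_itv.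
rewrite (carried_by_unitE c1)// (carried_by_unitE c2)//.
set W := V `&` _.
have mW : measurable (W : set X) by exact: measurableI.
have clamp1 : clamp 1 = 1 :> R by rewrite clampE//; lra.
have clampN1 : clamp (- 1) = 0 :> R.
  by rewrite /clamp (min_idPr _)// ?(max_idPl _)//; lra.
have small (k : cumulative R R) (H : R -> R) : (forall x, k x = H (clamp x)) ->
    H 1 - H 0 <= rho -> exists2 s : R, ls k W = s%:E & 0 <= s <= rho.
  move=> kE Hrho.
  have : (ls k W <= (H 1 - H 0)%:E)%E.
    have -> : (H 1 - H 0)%:E = ls k `](-1), 1]%classic.
      by rewrite lebesgue_stieltjes_itv ?kE ?clamp1 ?clampN1//; lra.
    apply: le_measure; rewrite ?inE//.
    by move=> x [_] /=; rewrite !in_itv/=; lra.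
  have : (0 <= ls k W)%E by exact: measure_ge0.
  case: (ls k W) => // s; rewrite !lee_fin => s0 s1.
  by exists s => //; lra.
have [s1 s1E s1P] := small f1 (fun x => F1 x - K x) f1E h1.
have [s2 s2E s2P] := small f2 (fun x => F2 x - K x) f2E h2.
have := e1 _ mW; rewrite e2// s1E s2E.
rewrite -(fineK (fin_num_measure nu1 W mW)) -(fineK (fin_num_measure nu2 W mW)).
by rewrite -!EFinD => -[] h; rewrite ler_norml; apply/andP; split; rewrite /= in h *; lra.
Qed.

End Stieltjes.

(** * Images of laws under the map *)
Lemma image_finite_measure d d' (X : measurableType d) (Y : measurableType d')
    (R : realType) (m : {finite_measure set X -> \bar R}) (f : X -> Y) :
  measurable_fun setT f ->
  {nu : {finite_measure set Y -> \bar R} | forall A, nu A = m (f @^-1` A)}.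
Proof.
move=> mf; pose m1 : {measure set Y -> \bar R} :=
  measure_function_pushforward__canonical__measure_function_Measure m mf.
have fin : fin_num_fun m1.
  move=> A mA; have := mf measurableT A mA; rewrite setTI => mfA.
  by rewrite /m1/= /pushforward fin_num_measure.
pose nu : {finite_measure set Y -> \bar R} := HB.pack (m1 : set Y -> \bar R)
  (Measure.class m1) (Measure_isFinite.Build _ _ _ m1 fin).
by exists nu.
Qed.

Section UnitLebesgue.
Context {R : realType}.
Local Notation X := (measurableTypeR R).
Implicit Types (c b x y : R) (A B V : set X).

Lemma lebesgue_unit_fin :
  (@lebesgue_measure R `[0%R, 1%R[%classic < +oo)%E.
Proof. by rewrite lebesgue_measure_itv/= lte_fin ltr01 ltry. Qed.

Lemma measurable_unit : measurable (`[0, 1[%classic : set X).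
Proof. exact: measurable_itv. Qed.

Definition unit_lebesgue : {finite_measure set X -> \bar R} :=
  mfrestr measurable_unit lebesgue_unit_fin.

Local Notation lam A := (fine (unit_lebesgue A)).

Lemma unit_lebesgueE A : unit_lebesgue A = lebesgue_measure (A `&` `[0, 1[%classic).
Proof. by []. Qed.

Lemma lam_itv x y (i j : bool) : 0 <= x -> x <= y -> y <= 1 ->
  lam [set` Interval (BSide i x) (BSide j y)] = y - x.
Proof.
move=> x0 xy y1; have mi : measurable ([set` Interval (BSide i x) (BSide j y)] : set X).
  exact: measurable_itv.
have m1 z : measurable ([set z] : set X) by exact: measurable_set1.
have l1 z : lebesgue_measure ([set z] : set X) = 0%E by exact: lebesgue_measure_set1.
have E : lebesgue_measure ([set` Interval (BSide i x) (BSide j y)] : set X)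
    = (y - x)%:E.
  rewrite lebesgue_measure_itv/= lte_fin; case: ltP => // yx.
  by congr _%:E; apply/eqP; rewrite eq_le; lra.
have mI := measurableI _ _ mi measurable_unit.
rewrite unit_lebesgueE (_ : lebesgue_measure _ = (y - x)%:E)// -E.
apply/eqP; rewrite eq_le le_measure ?inE//=.
apply: (@le_trans _ _ (lebesgue_measure (([set` Interval (BSide i x) (BSide j y)] `&` `[0, 1[%classic) `|` [set 1 : X]))).
  apply: le_measure; rewrite ?inE//; first exact: measurableU.
  move=> z zi; have [->|z1] := eqVneq z 1; first by right.
  left; split=> //; move: zi; rewrite /= !in_itv/=.
  case/andP => /lteifW h1 /lteifW h2; move: z1; rewrite lt_def eq_sym => z1.
  by rewrite z1/=; lra.
apply: le_trans (measureU2 _ _ _) _ => //.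
by rewrite [X in (_ + X)%E](l1 1) adde0.
Qed.

Lemma lam1 : lam setT = 1.
Proof.
have := @lam_itv 0 1 true true (lexx 0) ler01 (lexx 1).
by rewrite subr0 !unit_lebesgueE setTI setIid.
Qed.

Lemma lam_carried : carried_by_unit unit_lebesgue.
Proof. by rewrite /carried_by_unit unit_lebesgueE setICl measure0. Qed.

Lemma lam_le1 A : measurable A -> lam A <= 1.
Proof. by move=> mA; rewrite -lam1; exact: fine_measure_le. Qed.

(** The distribution function of the uniform law on [[c, b[]. *)
Definition ramp c b x := (Num.min x b - Num.min x c) / (b - c).

Lemma uniform_measure c b : 0 <= c -> c < b -> b <= 1 ->
  {m : {finite_measure set X -> \bar R} | [/\ carried_by_unit m,
    (forall A, measurable A -> fine (m A) = lam (A `&` `[c, b[%classic) / (b - c)) &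
    left_cdf m (ramp c b)]}.
Proof.
move=> c0 cb b1.
have mcb : measurable (`[c, b[%classic : set X) by exact: measurable_itv.
have r0 : 0 <= (b - c)^-1 by rewrite invr_ge0; lra.
pose m : {finite_measure set X -> \bar R} := mscale (NngNum r0) (mrestr unit_lebesgue mcb).
have mE A : m A = ((b - c)^-1%:E * unit_lebesgue (A `&` `[c, b[%classic))%E by [].
have fE A : measurable A -> fine (m A) = lam (A `&` `[c, b[%classic) / (b - c).
  move=> mA; rewrite mE fineM ?fin_num_measure//; last exact: measurableI.
  by rewrite mulrC.
exists m; split=> //.
  rewrite /carried_by_unit mE (_ : unit_lebesgue _ = 0%E) ?mule0//.
  rewrite unit_lebesgueE setIAC setICl set0I measure0//.
move=> x x01; rewrite fE; last exact: measurable_itv.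
congr (_ / _).
have -> : `[0, x[%classic `&` `[c, b[%classic =
    `[Num.min x c, Num.min x b[%classic :> set X.
  apply/seteqP; split=> y; rewrite /= !in_itv/=.
    by move=> [/andP[y0 yx] /andP[cy yb]]; rewrite lt_min yx yb ge_min cy orbT.
  rewrite lt_min ge_min => /and3P[h yx yb].
  have cy : c <= y by case/orP: h => //; rewrite leNgt yx.
  by rewrite yx cy yb (le_trans c0 cy).
rewrite lam_itv//.
- by rewrite le_min c0; lra.
- by rewrite le_min !ge_min lexx (ltW cb) !orbT.
- by rewrite ge_min b1 orbT.
Qed.

Section Ramp.
Variables (c b : R).
Hypotheses (c0 : 0 <= c) (cb : c < b) (b1 : b <= 1).

Lemma ramp_low x : x <= c -> ramp c b x = 0.
Proof.
by move=> xc; rewrite /ramp !min_l ?subrr ?mul0r// (le_trans xc)// ltW.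
Qed.

Lemma rampE x : c <= x -> ramp c b x = (Num.min x b - c) / (b - c).
Proof. by move=> xc; rewrite /ramp (min_r xc). Qed.

Lemma ramp_concave : concave_on c (ramp c b).
Proof.
have cb' := cb; move=> x y t hx hy ht; rewrite !rampE; [|nra..].
rewrite mulrA [(1 - t) * _]mulrA -mulrDl ler_pM2r ?invr_gt0; last lra.
suff : t * Num.min x b + (1 - t) * Num.min y b <= Num.min (t * x + (1 - t) * y) b.
  lra.
rewrite le_min; apply/andP; split.
  by rewrite lerD// ler_wpM2l ?ge_min ?lexx//; lra.
have h1 : t * Num.min x b <= t * b by rewrite ler_wpM2l ?ge_min ?lexx ?orbT//; lra.
have h2 : (1 - t) * Num.min y b <= (1 - t) * b.
  by rewrite ler_wpM2l ?ge_min ?lexx ?orbT//; lra.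
lra.
Qed.

Lemma ramp_nondecreasing : nondecreasing_on 0 (ramp c b).
Proof.
have cb' := cb; move=> x y x0 xy y1; rewrite /ramp ler_pM2r ?invr_gt0; last lra.
rewrite /Num.min; do 4! case: ltP => ?; lra.
Qed.

Lemma ramp_lipschitz x y : 0 <= x -> x <= y -> y <= 1 ->
  ramp c b y - ramp c b x <= (b - c)^-1 * (y - x).
Proof.
have cb' := cb; move=> x0 xy y1; rewrite /ramp -mulrBl mulrC ler_pM2l ?invr_gt0; last lra.
rewrite /Num.min; do 4! case: ltP => ?; lra.
Qed.

Lemma ramp0 : ramp c b 0 = 0. Proof. by rewrite ramp_low. Qed.

Lemma ramp1 : ramp c b 1 = 1.
Proof.
have cb' := cb; have b1' := b1; rewrite rampE; last lra.
by rewrite (min_r b1) divff//; lra.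
Qed.

Lemma ramp_le x : 0 <= x -> ramp 0 b x <= x / b.
Proof.
have cb' := cb; have c0' := c0; move=> x0.
rewrite /ramp subr0 ler_pM2r ?invr_gt0; last lra.
by rewrite (min_r x0) subr0 ge_min lexx.
Qed.

End Ramp.
End UnitLebesgue.

Notation lam A := (fine (unit_lebesgue A)).

Section ImageLaws.
Context {R : realType} {alpha : R} (alpha0 : 0 < alpha) (alpha1 : alpha < 1).
Local Notation X := (measurableTypeR R).
Local Notation T := (T_alpha alpha).
Local Notation g := (@left_inv R alpha).
Local Notation a := (@a_ R g).
Let gP : full_branch g := left_inv_full_branch alpha0 alpha1.
Implicit Types (x y c b : R) (n k : nat) (A V : set X).

Lemma T_left x : 0 <= x -> x < 2^-1 -> T x = @left_map R alpha x.
Proof. by move=> x0 x1; rewrite /T_alpha x0 x1. Qed.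

Lemma T_right x : 2^-1 <= x -> T x = 2 * x - 1.
Proof. by move=> x1; rewrite /T_alpha [_ < _]ltNge x1 andbF. Qed.

Lemma T_neg x : x < 0 -> T x = 2 * x - 1.
Proof. by move=> x1; rewrite /T_alpha leNgt x1. Qed.

Lemma measurable_T : measurable_fun [set: X] (T : X -> X).
Proof.
apply: measurable_fun_ifT => /=.
- apply: measurable_and; first exact: measurable_fun_ler.
  exact: measurable_fun_ltr.
- apply: measurable_funM => //; apply: measurable_funD => //.
  by apply: measurable_funM => //; exact: measurable_powR.
- by apply: measurable_funB => //; exact: measurable_funM.
Qed.

Lemma measurable_iter n : measurable_fun [set: X] (iter n T : X -> X).
Proof.
elim: n => [|n ih] /=; first exact: measurable_id.
exact: (measurableT_comp measurable_T ih).
Qed.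

Lemma measurable_iter_preimage n A :
  measurable A -> measurable (iter n T @^-1` A : set X).
Proof. exact: (measurable_preimage_iter measurable_T). Qed.

Lemma T_preimage y : 0 <= y <= 1 ->
  T @^-1` `[0, y[%classic = `[0, g y[%classic `|` `[2^-1, (1 + y) / 2[%classic.
Proof.
move=> y01; have [hg1 hg2] := left_invP alpha0 alpha1 y01.
apply/seteqP; split=> x /=; rewrite !in_itv/=.
  have [x0|x0] := ltP x 0; first by rewrite T_neg//; lra.
  have [x1|x1] := ltP x 2^-1; last by rewrite T_right//; right; lra.
  rewrite T_left// => /andP[_ h]; left; apply/andP; split=> //; rewrite ltNge; apply/negP => gx.
  have := left_map_expand alpha0 alpha1 (proj1 (andP hg1)) gx; lra.
case=> /andP[h1 h2].
  have x1 : x < 2^-1 by lra.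
  rewrite T_left//; have := left_map_expand alpha0 alpha1 (lexx 0) h1.
  rewrite left_map0 => h3; apply/andP; split; first lra.
  have := left_map_expand alpha0 alpha1 h1 (ltW h2); lra.
by rewrite T_right//; lra.
Qed.

Lemma T_unit x : 0 <= x < 1 -> 0 <= T x < 1.
Proof.
move=> x01; have := @T_preimage 1 ltac:(lra).
rewrite (branch1 gP) (_ : (1 + 1) / 2 = 1 :> R); last lra.
move=> /seteqP[_ /(_ x)] /=; rewrite !in_itv/=; apply.
by have [x1|x1] := ltP x 2^-1; [left|right]; lra.
Qed.

Lemma iterT_unit n x : 0 <= x < 1 -> 0 <= iter n T x < 1.
Proof. by move=> x01; elim: n => //= n ih; exact: T_unit. Qed.

Lemma cdf_iter (m : {finite_measure set X -> \bar R}) F n y :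
  left_cdf m F -> 0 <= y <= 1 ->
  fine (m (iter n T @^-1` `[0, y[%classic)) = pushn (g := g) n F y.
Proof.
move=> hF; have mitv (i : interval R) : measurable ([set` i] : set X).
  exact: measurable_itv.
elim: n y => [|n ih] y y01; first by rewrite /pushn/= hF.
have gy := branch_range gP y01; have gy1 := branch_le_half gP y01.
have -> : iter n.+1 T @^-1` `[0, y[%classic =
  iter n T @^-1` `[0, g y[%classic `|` iter n T @^-1` `[2^-1, (1 + y) / 2[%classic.
  by rewrite -preimage_setU -T_preimage.
have -> : iter n T @^-1` `[2^-1, (1 + y) / 2[%classic =
  iter n T @^-1` `[0, (1 + y) / 2[%classic `\` iter n T @^-1` `[0, 2^-1[%classic.
  apply/seteqP; split=> x /=; rewrite !in_itv/=; first by move=> h; split; lra.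
  by move=> [h1 /negP h2]; lra.
have m1 z : measurable (iter n T @^-1` `[0, z[%classic : set X).
  exact: measurable_iter_preimage.
rewrite fine_measureU//; last 2 first.
- exact: measurableD.
- by apply/seteqP; split=> // x [] /=; rewrite !in_itv/= => h1 [h2 /negP h3]; lra.
rewrite pushnS /push -!ih; [|lra..].
rewrite [X in _ = _ + X - _](fine_measure_split m (m1 _) (m1 2^-1)).
rewrite (_ : iter n T @^-1` `[0, (1 + y) / 2[%classic `&` iter n T @^-1` `[0, 2^-1[%classic
  = iter n T @^-1` `[0, 2^-1[%classic); first lra.
by apply/seteqP; split=> x /=; rewrite !in_itv/=; [case|move=> h; split; lra].
Qed.

Lemma carried_image (m nu : {finite_measure set X -> \bar R}) n :
  carried_by_unit m -> (forall A, nu A = m (iter n T @^-1` A)) ->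
  carried_by_unit nu.
Proof.
move=> cm nuE; rewrite /carried_by_unit nuE; apply/eqP.
rewrite eq_le measure_ge0 andbT -cm.
apply: le_measure; rewrite ?inE.
- by apply: measurable_iter_preimage; apply: measurableC; exact: measurable_unit.
- by apply: measurableC; exact: measurable_unit.
- move=> x /= hx /= h'; apply: hx; move: h'; rewrite !in_itv/=.
  exact: iterT_unit.
Qed.

(** The Lipschitz bound only serves to exclude atoms.  The last bound keeps mass away
from the neutral fixed point at all times, with [q] chosen beforehand. *)
Definition mixing_cdf q (rho : R) (m : {finite_measure set X -> \bar R}) F :=
  [/\ carried_by_unit m, left_cdf m F,
   exists2 L, 0 <= L & forall x y, 0 <= x -> x <= y -> y <= 1 ->
     F y - F x <= L * (y - x)
   & [/\ concave_on 0 F, nondecreasing_on 0 F, F 0 = 0, F 1 = 1 &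
     forall n, pushn (g := g) n F (a q) <= rho / 2]].

(** The images of the two laws share the part that [pushn_mixing] splits off. *)
Lemma equilibration q (rho : R) : 0 < rho -> exists M : nat, forall m1 m2 F1 F2,
  mixing_cdf q rho m1 F1 -> mixing_cdf q rho m2 F2 -> forall V, measurable V ->
    `|fine (m1 (iter M T @^-1` V)) - fine (m2 (iter M T @^-1` V))| <= rho.
Proof.
move=> rho0; have [M [K hK]] := pushn_mixing gP q rho0; exists M.
move=> m1 m2 F1 F2 hm1 hm2 V mV.
have image m F : mixing_cdf q rho m F ->
   exists nu : {finite_measure set X -> \bar R}, exists L, [/\ carried_by_unit nu,
     left_cdf nu (pushn (g := g) M F), 0 <= L, (forall A, nu A = m (iter M T @^-1` A))
     & [/\ forall x y, 0 <= x -> x <= y -> y <= 1 ->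
         pushn (g := g) M F y - pushn (g := g) M F x <= L * (y - x),
       nondecreasing_on 0 (fun x => pushn (g := g) M F x - K x),
       nondecreasing_on 0 K &
       (pushn (g := g) M F 1 - K 1) - (pushn (g := g) M F 0 - K 0) <= rho]].
  move=> [cm hF [L L0 lF] [cF nF F0 F1' tF]].
  have [nu nuE] := image_finite_measure m (measurable_iter M).
  have [L' L'0 lF'] := pushn_lipschitz gP M L0 lF.
  have [nR nK K0 K1] := hK F cF nF F0 F1' tF.
  exists nu, L'; split => //.
  - exact: (carried_image cm nuE).
  - by move=> x x01; rewrite nuE (cdf_iter _ hF).
  - by split=> //; rewrite (pushn1 gP) (pushn0 gP) F0 F1' K0; lra.
have [nu1 [L1 [c1 d1 L10 e1 [l1 n1 nK r1]]]] := image _ _ hm1.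
have [nu2 [L2 [c2 d2 L20 e2 [l2 n2 _ r2]]]] := image _ _ hm2.
rewrite -e1 -e2.
apply: (@common_part_bound _ nu1 nu2 _ _ K (L1 + L2) _ _ c1 c2 d1 d2) => //.
  exact: addr_ge0.
move=> x y x0 xy y1; split.
  by apply: (le_trans (l1 _ _ x0 xy y1)); rewrite ler_wpM2r//; lra.
by apply: (le_trans (l2 _ _ x0 xy y1)); rewrite ler_wpM2r//; lra.
Qed.

End ImageLaws.

(** * Orbits without long excursions or fast returns *)
(** By the Borel-Cantelli lemma almost every point lies in finitely many of the sets
[B j (s j)] only.  Each of those finitely many [j] is dealt with by shrinking
the parameter to some [t K], which leaves only a null set for every [j]. *)
Lemma eventually_avoid d (X : measurableType d) (R : realType)
    (m : {finite_measure set X -> \bar R}) (B : nat -> R -> set X)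
    (s t : nat -> R) (C C' : R) (j0 : nat) :
  (forall j u, measurable (B j u)) ->
  (forall j u v, u <= v -> B j u `<=` B j v) ->
  (forall n, \sum_(0 <= j < n) s j <= C) -> (forall j, 0 <= s j) -> 0 <= C' ->
  (forall j, (j0 <= j)%N -> fine (m (B j (s j))) <= C' * s j) ->
  {homo t : i j / (i <= j)%N >-> j <= i} ->
  (forall j, m (\bigcap_k B j (t k)) = 0%E) ->
  exists N, [/\ measurable N, m N = 0%E & forall x, ~ N x ->
    exists K, forall j, ~ B j (Num.min (s j) (t K)) x].
Proof.
move=> mB homB sumC s0 C'0 mBs tdec null.
pose N1 := lim_sup_set (fun j => B (j0 + j)%N (s (j0 + j)%N)).
pose N2 := \bigcup_j \bigcap_k B j (t k).
have mN1 : measurable N1.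
  apply: bigcapT_measurable => n; apply: bigcup_measurable => k _; exact: mB.
have mI j : measurable (\bigcap_k B j (t k)).
  by apply: bigcapT_measurable => k; exact: mB.
have mN2 : measurable N2 by apply: bigcupT_measurable.
have N10 : m N1 = 0%E.
  apply: lim_sup_set_cvg0 => // ; apply: (@le_lt_trans _ _ (C' * C)%:E); last exact: ltry.
  apply: lime_le.
    by apply: is_cvg_nneseries => n _ _; exact: measure_ge0.
  apply: nearW => n.
  have -> : (\sum_(0 <= i < n) m (B (j0 + i)%N (s (j0 + i)%N)) =
      (\sum_(0 <= i < n) fine (m (B (j0 + i)%N (s (j0 + i)%N))))%:E)%E.
    rewrite -sumEFin; apply: eq_bigr => i _.
    by rewrite fineK// fin_num_measure.
  rewrite lee_fin; apply: (@le_trans _ _ (\sum_(0 <= i < n) C' * s (j0 + i)%N)).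
    by apply: ler_sum => i _; apply: mBs; rewrite leq_addr.
  rewrite -mulr_sumr ler_wpM2l//; apply: le_trans (sumC (j0 + n)%N).
  elim: n => [|n ih]; first by rewrite big_nil sumr_ge0.
  by rewrite addnS !big_nat_recr//= lerD2r.
have N20 : m N2 = 0%E.
  apply/(measure_negligible mN2)/negligible_bigcup => j.
  by exists (\bigcap_k B j (t k)); split; [exact: mI|exact: null|].
exists (N1 `|` N2); split; first exact: measurableU.
  apply/(measure_negligible (measurableU _ _ mN1 mN2))/negligibleU.
    by exists N1; split.
  by exists N2; split.
move=> x /not_orP[xN1 xN2].
have [n hn] : exists n, forall k, (n <= k)%N -> ~ B (j0 + k)%N (s (j0 + k)%N) x.
  apply: contrapT => h; apply: xN1 => n _; apply: contrapT => h'.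
  by apply: h; exists n => k nk Bk; apply: h'; exists k.
have hK j : exists K, ~ B j (t K) x.
  apply: contrapT => h; apply: xN2; exists j => // k _; apply: contrapT => h'.
  by apply: h; exists k.
have [K hKall] : exists K, forall j, (j < j0 + n)%N -> ~ B j (t K) x.
  elim: (j0 + n)%N => [|p [K ih]]; first by exists 0%N.
  have [K' hK'] := hK p; exists (maxn K K') => j.
  rewrite ltnS leq_eqVlt => /predU1P[->|jp] Bx.
    by apply: hK'; apply: homB Bx; apply: tdec; rewrite leq_maxr.
  by apply: (ih _ jp); apply: homB Bx; apply: tdec; rewrite leq_maxl.
exists K => j Bx; have [jn|nj] := ltnP j (j0 + n).
  by apply: (hKall _ jn); apply: homB Bx; rewrite ge_min lexx orbT.
apply: (hn (j - j0)%N); first lia.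
rewrite subnKC; last lia.
by apply: homB Bx; rewrite ge_min lexx.
Qed.

Section GoodSets.
Context {R : realType} {alpha : R} (alpha0 : 0 < alpha) (alpha1 : alpha < 1).
Local Notation X := (measurableTypeR R).
Local Notation T := (T_alpha alpha).
Local Notation g := (@left_inv R alpha).
Local Notation a := (@a_ R g).
Let gP : full_branch g := left_inv_full_branch alpha0 alpha1.
Implicit Types (x y c b : R) (n k : nat) (A V : set X).

Lemma left_cdf_id : left_cdf (@unit_lebesgue R) id.
Proof. by move=> x x01; rewrite lam_itv ?subr0//; lra. Qed.

Lemma id_concave : concave_on 0 (@id R).
Proof. by move=> x y t _ _ _. Qed.

Lemma id_nondecreasing : nondecreasing_on 0 (@id R).
Proof. by []. Qed.

(** A point of [[1/2, (1 + u) / 2[] is mapped into [[0, u[], from where the orbit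
needs a long time to leave the neighbourhood of 0. *)
Definition excursion j (u : R) : set X :=
  iter j T @^-1` `[2^-1, (1 + u) / 2[%classic.

Lemma measurable_excursion j u : measurable (excursion j u).
Proof. by apply: measurable_iter_preimage; exact: measurable_itv. Qed.

(** The image of Lebesgue measure has a nonincreasing density, which is therefore at
most 2 to the right of 1/2. *)
Lemma lam_excursion j u : 0 <= u <= 1 -> lam (excursion j u) <= u.
Proof.
move=> u01; have m1 z : measurable (iter j T @^-1` `[0, z[%classic : set X).
  by apply: measurable_iter_preimage; exact: measurable_itv.
have -> : excursion j u = iter j T @^-1` `[0, (1 + u) / 2[%classic `\`
    iter j T @^-1` `[0, 2^-1[%classic.
  apply/seteqP; split=> x; rewrite /excursion /= !in_itv/=.
    by move=> h; split; lra.
  by move=> [h1 /negP h2]; lra.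
have := fine_measure_split (@unit_lebesgue R) (m1 ((1 + u) / 2)) (m1 2^-1).
rewrite (_ : _ `&` iter j T @^-1` `[0, 2^-1[%classic
  = iter j T @^-1` `[0, 2^-1[%classic); last first.
  by apply/seteqP; split=> x /=; rewrite !in_itv/=; [case|move=> h; split; lra].
rewrite !(cdf_iter alpha0 alpha1 _ left_cdf_id); [|lra..].
have cP := pushn_concave gP j id_concave id_nondecreasing.
have nP := pushn_nondecreasing gP j id_nondecreasing.
have := concave_on_slopes cP (x := 0) (y := 2^-1) (u := 2^-1) (v := (1 + u) / 2).
move=> /(_ ltac:(lra) ltac:(lra) ltac:(lra) ltac:(lra) ltac:(lra) ltac:(lra)).
rewrite (pushn0 gP) subr0.
have h1 : pushn (g := g) j id 2^-1 <= 1.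
  by rewrite -[leRHS](pushn1 gP j id); apply: nP; lra.
have h2 : pushn (g := g) j id 2^-1 * ((1 + u) / 2 - 2^-1) <= 1 * ((1 + u) / 2 - 2^-1).
  by rewrite ler_wpM2r//; lra.
lra.
Qed.

Definition no_long_excursion K : set X := [set x | a K <= x < 1 /\
  forall j, ~ excursion j (Num.min (a j) (a K)) x].

(** Suppose that [T^n x < a n] and go back in time.  The orbit can have entered [[0, a (n + i)[]
from the right of 1/2 only through an excursion that is forbidden, so it came
from [[0, a (n + i).+1[] through the left branch.  After [n] steps this gives
[x < a (n + n)], which contradicts [a K <= x]. *)
Lemma no_long_excursion_ge K n x : no_long_excursion K x -> (K <= n)%N ->
  a n <= iter n T x.
Proof.
move=> [xK hx] Kn; rewrite leNgt; apply/negP => hn.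
have aK0 := a_gt0 alpha0 alpha1.
have x01 : 0 <= x < 1 by have := aK0 K; lra.
have back i : (i <= n)%N -> iter (n - i) T x < a (n + i).
  elim: i => [|i ih] iltn; first by rewrite subn0 addn0.
  pose y := iter (n - i.+1) T x.
  have hy : T y < a (n + i).
    have := ih (ltnW iltn); rewrite (_ : (n - i = (n - i.+1).+1)%N) //; lia.
  have y01 : 0 <= y < 1 by apply: (iterT_unit alpha0 alpha1).
  have Ty01 : 0 <= T y < 1 by exact: (T_unit alpha0 alpha1).
  have := T_preimage alpha0 alpha1 (y := a (n + i)) (a_range gP _).
  move=> /seteqP[/(_ y) h _]; have {h} := h _; rewrite /= !in_itv/= => h.
  have [|h1|h1] := h; first lra.
    by rewrite addnS aS -/y; lra.
  exfalso; apply: (hx (n - i.+1)%N); rewrite /excursion /= in_itv/= -/y.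
  have m : a (n + i) <= Num.min (a (n - i.+1)) (a K).
    rewrite le_min; apply/andP; split; apply: (a_nonincr alpha0 alpha1).
      exact: leq_trans (leq_subr _ _) (leq_addr _ _).
    exact: leq_trans Kn (leq_addr _ _).
  lra.
have := back n (leqnn n); rewrite subnn /= => h.
have : a (n + n) <= a K by apply: (a_nonincr alpha0 alpha1); lia.
lra.
Qed.

Lemma measurable_no_long_excursion K : measurable (no_long_excursion K).
Proof.
rewrite (_ : no_long_excursion K = `[a K, 1[%classic `&`
  \bigcap_j ~` excursion j (Num.min (a j) (a K))).
  apply: measurableI; first exact: measurable_itv.
  by apply: bigcapT_measurable => j; apply: measurableC; exact: measurable_excursion.
apply/seteqP; split=> x /=; rewrite in_itv/=.
  by move=> [h1 h2]; split=> // j _; exact: h2.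
by move=> [h1 h2]; split=> // j; exact: h2.
Qed.

Lemma no_long_excursion_ae : exists N : set X, [/\ measurable N, lam N = 0 &
  forall x, 0 <= x < 1 -> ~ N x -> exists K, no_long_excursion K x].
Proof.
have al1 := alpha1; have al0 := alpha0.
have aP := a_gt0 alpha0 alpha1.
have [C C0 hC] := sum_a_bounded alpha0 alpha1 alpha1.
have [||||||||N [mN N0 hN]] := @eventually_avoid _ X R (@unit_lebesgue R)
  (fun j u => excursion j u) a a C 1 0.
- by move=> j u; exact: measurable_excursion.
- move=> j u v uv x; rewrite /excursion /= !in_itv/=; lra.
- move=> n; apply: le_trans (hC n); apply: ler_sum => j _.
  by rewrite powRr1// ltW.
- by move=> j; exact: ltW.
- by [].
- by move=> j _; rewrite mul1r lam_excursion// (a_range gP).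
- by move=> i j ij; exact: (a_nonincr alpha0 alpha1).
- move=> j; have mI : measurable (\bigcap_k excursion j (a k)).
    by apply: bigcapT_measurable => k; exact: measurable_excursion.
  rewrite -[LHS]fineK ?fin_num_measure//; congr _%:E.
  apply/eqP; rewrite eq_le fine_measure_ge0 andbT; apply/ler_addgt0Pr => e e0.
  have [n hn] := a_small alpha0 alpha1 e0.
  rewrite add0r; apply: le_trans hn.
  apply: (le_trans _ (lam_excursion j (a_range gP n))).
  apply: fine_measure_le => //; first exact: measurable_excursion.
  by move=> x; apply.
have m0 : measurable ([set 0] : set X) by exact: measurable_set1.
exists (N `|` [set 0]); split; first exact: measurableU.
  apply/eqP; rewrite eq_le fine_measure_ge0 andbT.
  have := fine_measure_cover (@unit_lebesgue R) mN m0 (measurableU _ _ mN m0)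
    (@subset_refl _ _).
  have l0 : lam ([set 0] : set X) = 0 by rewrite -set_itv1 lam_itv ?subrr.
  by rewrite N0 l0 addr0.
move=> x x01 /not_orP[xN x0].
have [K hK] := hN _ xN.
have xp : 0 < x by rewrite lt_neqAle eq_sym; apply/andP; split;
  [apply/eqP|case/andP: x01].
have [n hn] := a_small alpha0 alpha1 xp.
exists (maxn K n); split.
  have := a_nonincr alpha0 alpha1 (leq_maxr K n); lra.
move=> j; apply: contra_not (hK j); rewrite /excursion /= !in_itv/=.
have : Num.min (a j) (a (maxn K n)) <= Num.min (a j) (a K).
  by rewrite le_min !ge_min lexx (a_nonincr alpha0 alpha1 (leq_maxl K n)) orbT.
lra.
Qed.

(** [G] is the inverse branch of some iterate already composed; an induction on [j]
reaches all inverse branches of [T^j], with [y] as the value [T^j x] and [G y]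
as [x].  At the end of the induction [G] has total increment at most
[dl / 2], so its slope beyond [dl] is at most [(G 1 - G 0) / dl <= 1/2] by
concavity.  Hence the [y >= dl] with [|y - G y| <= rho] fill at most a length
[4 * rho], and their images at most [4 * rho * (G 1 - G 0) / dl].  Over all
branches the increments [G 1 - G 0] add up to the initial one. *)
Lemma self_return_cover (dl rho : R) j G : 0 < dl -> 0 <= rho ->
  concave_on 0 G -> nondecreasing_on 0 G ->
  (forall u v, 0 <= u -> u <= v -> v <= 1 -> v - u <= a j -> G v - G u <= dl / 2) ->
  exists C : set X, [/\ measurable C, lam C <= 4 * rho / dl * (G 1 - G 0) &
    forall y, 0 <= y < 1 -> dl <= iter j T y -> `|iter j T y - G y| <= rho -> C (G y)].
Proof.
move=> dl0 rho0; elim: j G => [|j ih] G cG nG osc.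
  have G10 : G 1 - G 0 <= dl / 2 by apply: osc; rewrite /a_/=; lra.
  have G01 : G 0 <= G 1 by apply: nG.
  pose L := 4 * rho / dl * (G 1 - G 0).
  have c0 : 0 <= 4 * rho / dl by rewrite divr_ge0//; lra.
  have L0 : 0 <= L by rewrite mulr_ge0//; lra.
  pose S := [set p | exists2 y, [/\ 0 <= y < 1, dl <= y & `|y - G y| <= rho] & p = G y].
  have [[p0 Sp0]|S0] := pselect (S !=set0); last first.
    exists set0; split; [exact: measurable0|by rewrite measure0|].
    by move=> y y01 dy hy; apply: S0; exists (G y); exists y.
  have close y1 y2 : [/\ 0 <= y1 < 1, dl <= y1 & `|y1 - G y1| <= rho] ->
      [/\ 0 <= y2 < 1, dl <= y2 & `|y2 - G y2| <= rho] -> G y2 - G y1 <= L.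
    move=> [h1 d1 /ler_normlP[l1 r1]] [h2 d2 /ler_normlP[l2 r2]].
    have [y21|y12] := leP y2 y1.
      by have := nG y2 y1 ltac:(lra) y21 ltac:(lra); lra.
    have := concave_on_slopes cG (x := 0) (y := y1) (u := y1) (v := y2).
    move=> /(_ ltac:(lra) ltac:(lra) ltac:(lra) ltac:(lra) ltac:(lra) ltac:(lra)).
    rewrite subr0 => sl.
    have Gy1 : G y1 - G 0 <= G 1 - G 0 by rewrite lerD2r; apply: nG; lra.
    have sl1 : (G y2 - G y1) * dl <= (G y2 - G y1) * y1.
      by rewrite ler_wpM2l// subr_ge0; apply: nG; lra.
    have sl2 : (G y1 - G 0) * (y2 - y1) <= (G 1 - G 0) * (y2 - y1).
      by rewrite ler_wpM2r//; lra.
    have sl3 : (G 1 - G 0) * (y2 - y1) <= dl / 2 * (y2 - y1).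
      by rewrite ler_wpM2r//; lra.
    have half : G y2 - G y1 <= (y2 - y1) / 2.
      rewrite -(ler_pM2r dl0); lra.
    have y4 : y2 - y1 <= 4 * rho by lra.
    have sl4 : (G 1 - G 0) * (y2 - y1) <= (G 1 - G 0) * (4 * rho).
      by rewrite ler_wpM2l//; lra.
    rewrite -(ler_pM2r dl0) /L.
    have -> : 4 * rho / dl * (G 1 - G 0) * dl = (G 1 - G 0) * (4 * rho).
      by field; lra.
    lra.
  have lbS : has_lbound S.
    exists (p0 - L) => p [y hy ->]; case: Sp0 => y0 hy0 ->.
    have := close _ _ hy hy0; lra.
  exists (`[inf S, inf S + L]%classic); split; first exact: measurable_itv.
    apply: (@le_trans _ _ (fine (@lebesgue_measure R `[inf S, inf S + L]%classic))).
      apply: fine_le.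
      - by apply: fin_num_measure; exact: measurable_itv.
      - by rewrite lebesgue_measure_itv/=; case: ifP.
      - rewrite unit_lebesgueE; apply: le_measure; rewrite ?inE//.
        by apply: measurableI; [exact: measurable_itv|exact: measurable_unit].
    rewrite lebesgue_measure_itv/= lte_fin; case: ifP => _ //=.
    by rewrite addrAC subrr add0r.
  move=> y y01 dy hy; have Sy : S (G y) by exists y.
  rewrite /= in_itv/= ge_inf//= -lerBlDr.
  apply: lb_le_inf; first by exists (G y).
  by move=> p [z hz ->]; have := close z y hz; move=> /(_ (And3 y01 dy hy)); lra.
have hr x : 0 <= x <= 1 -> 0 <= (1 + x) / 2 <= 1 by lra.
have [||C1 [mC1 lC1 hC1]] := ih (fun x => G (g x)) (concave_on_comp cG nG (branch_concave gP) (branch_range gP)).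
- move=> x y x0 xy y1; apply: nG; [|exact: (branch_mono gP)|].
    by have := branch_range gP (x := x) ltac:(lra); lra.
  by have := branch_range gP (x := y) ltac:(lra); lra.
- move=> u v u0 uv v1 vu; apply: osc.
  + by have := branch_range gP (x := u) ltac:(lra); lra.
  + exact: (branch_mono gP).
  + by have := branch_range gP (x := v) ltac:(lra); lra.
  + apply: (le_trans (branch_subadd gP u0 uv v1)); rewrite aS.
    by apply: (branch_mono gP) => //; [lra|have := a_range gP j; lra].
have [|||C2 [mC2 lC2 hC2]] := ih (fun x => G ((1 + x) / 2)).
- by apply: (concave_on_comp cG nG _ hr) => x y t _ _ _; lra.
- by move=> x y x0 xy y1; apply: nG; lra.
- move=> u v u0 uv v1 vu; apply: osc; [lra..|].
  by have := branch_ge_half gP (a_range gP j); rewrite aS; lra.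
exists (C1 `|` C2); split; first exact: measurableU.
  have := fine_measure_cover (@unit_lebesgue R) mC1 mC2 (measurableU _ _ mC1 mC2)
    (@subset_refl _ _).
  move: lC1 lC2; rewrite (branch0 gP) (branch1 gP) addr0 mul1r.
  by rewrite (_ : (1 + 1) / 2 = 1 :> R); lra.
move=> y y01; rewrite iterSr => h1 h2.
have Ty := T_unit alpha0 alpha1 y01.
have [yl|yr] := ltP y 2^-1.
  have E : G y = G (g (T y)).
    by rewrite T_left ?left_invK//; lra.
  by left; rewrite E; apply: hC1 => //; rewrite -E.
have E : G y = G ((1 + T y) / 2) by rewrite T_right//; congr G; lra.
by right; rewrite E; apply: hC2 => //; rewrite -E.
Qed.

Definition self_return (dl : R) j (u : R) : set X :=
  [set x | [/\ (0 < j)%N, 0 <= x < 1, dl <= iter j T x & `|iter j T x - x| <= u]].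

Lemma measurable_self_return dl j u : measurable (self_return dl j u).
Proof.
have [->|j0] := posnP j.
  by rewrite (_ : self_return _ _ _ = set0)//; apply/seteqP; split=> // x [].
rewrite (_ : self_return dl j u = (`[0, 1[%classic `&` iter j T @^-1` `[dl, +oo[%classic)
   `&` (fun x => iter j T x - x) @^-1` `[- u, u]%classic).
  apply: measurableI; first apply: measurableI.
  - exact: measurable_unit.
  - by apply: measurable_iter_preimage; exact: measurable_itv.
  - have mf : measurable_fun [set: X] (fun x : X => iter j T x - x : R).
      by apply: measurable_funB; [exact: measurable_iter|exact: measurable_id].
    rewrite -[X in measurable X]setTI; apply: mf => //; exact: measurable_itv.
apply/seteqP; split=> x /=; rewrite !in_itv/= andbT.
  by move=> [_ h1 h2 h3]; rewrite -ler_norml.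
by move=> [[h1 h2]]; rewrite -ler_norml.
Qed.

Lemma lam_self_return dl j u : 0 < dl -> 0 <= u -> a j <= dl / 2 ->
  lam (self_return dl j u) <= 4 * u / dl.
Proof.
move=> dl0 u0 aj.
have [|C [mC lC hC]] := self_return_cover dl0 u0 id_concave id_nondecreasing (j := j).
  by move=> p q _ _ _ h; apply: le_trans aj.
apply: (@le_trans _ _ (lam C)); last by rewrite subr0 mulr1 in lC.
apply: fine_measure_le => //; first exact: measurable_self_return.
by move=> x [_ x01 dx hx]; exact: hC.
Qed.

(** A point with [T^j x = x] also satisfies [T^(j * i) x = x] for all [i], and for large
[i] the cylinders of level [j * i] are short enough for the preceding bound. *)
Lemma lam_periodic dl j : 0 < dl -> (0 < j)%N ->
  lam (self_return dl j 0) = 0.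
Proof.
move=> dl0 j0; apply/eqP; rewrite eq_le fine_measure_ge0 andbT.
have [n hn] := a_small alpha0 alpha1 (ltac:(lra) : 0 < dl / 2).
have -> : 0 = 4 * 0 / dl :> R by rewrite mulr0 mul0r.
have jn : (n <= j * n.+1)%N by nia.
apply: le_trans (lam_self_return dl0 (lexx 0)
  (le_trans (a_nonincr alpha0 alpha1 jn) hn)).
apply: fine_measure_le; [exact: measurable_self_return..|].
move=> x [_ x01 dx] /ler_normlP[h1 h2].
have xE : iter j T x = x by apply/eqP; rewrite eq_le; lra.
have itE k : iter (j * k) T x = x.
  by elim: k => [|k ih]; rewrite ?muln0// mulnS iterD ih.
split=> //; [lia| |]; rewrite itE; last by rewrite subrr normr0.
by rewrite -xE.
Qed.

Section NoReturn.
Variable theta : R.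
Hypotheses (th1 : alpha < theta) (th2 : theta < 1).

(** The division by 4 is there because a ball whose radius is adapted to [a k] will be
followed during up to [4 * k] steps. *)
Definition return_scale j := a (j %/ 4) `^ theta.

Lemma sum_return_scale : exists2 C, 0 <= C &
  forall n, \sum_(0 <= j < n) return_scale j <= C.
Proof.
have [C C0 hC] := sum_a_bounded alpha0 alpha1 th1.
exists (4 * C) => [|n]; first by rewrite mulr_ge0.
have s0 j : 0 <= return_scale j by exact: powR_ge0.
apply: (@le_trans _ _ (\sum_(0 <= j < n * 4) return_scale j)).
  rewrite [leRHS](@big_cat_nat _ _ _ n)//=; last by lia.
  by rewrite lerDl sumr_ge0.
apply: (@le_trans _ _ (4 * \sum_(0 <= k < n) a k `^ theta)); last first.
  by rewrite ler_wpM2l.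
elim: n => [|n ih]; first by rewrite !big_nil mulr0.
rewrite [X in _ <= _ * X]big_nat_recr//= mulrDr.
rewrite (_ : (n.+1 * 4 = (n * 4).+4)%N); last lia.
rewrite (big_nat_recr (n * 4).+3)//= (big_nat_recr (n * 4).+2)//=.
rewrite (big_nat_recr (n * 4).+1)//= (big_nat_recr (n * 4)%N)//=.
rewrite /return_scale.
have -> : (n * 4 %/ 4 = n)%N by lia.
have -> : ((n * 4).+1 %/ 4 = n)%N by lia.
have -> : ((n * 4).+2 %/ 4 = n)%N by lia.
have -> : ((n * 4).+3 %/ 4 = n)%N by lia.
move: ih; rewrite /return_scale; lra.
Qed.

Definition no_fast_return dl K : set X := [set x | 0 <= x < 1 /\
  forall j, ~ self_return dl j (Num.min (return_scale j) (a K)) x].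

Lemma measurable_no_fast_return dl K : measurable (no_fast_return dl K).
Proof.
rewrite (_ : no_fast_return dl K = `[0, 1[%classic `&`
  \bigcap_j ~` self_return dl j (Num.min (return_scale j) (a K))).
  apply: measurableI; first exact: measurable_unit.
  by apply: bigcapT_measurable => j; apply: measurableC; exact: measurable_self_return.
apply/seteqP; split=> x /=; rewrite in_itv/=.
  by move=> [h1 h2]; split=> // j _; exact: h2.
by move=> [h1 h2]; split=> // j; exact: h2.
Qed.

Lemma no_fast_return_ae dl : 0 < dl ->
  exists N : set X, [/\ measurable N, lam N = 0 &
  forall x, 0 <= x < 1 -> ~ N x -> exists K, no_fast_return dl K x].
Proof.
move=> dl0; have aP := a_gt0 alpha0 alpha1.
have [C C0 hC] := sum_return_scale.
have [n hn] := a_small alpha0 alpha1 (ltac:(lra) : 0 < dl / 2).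
have [||||||||N [mN N0 hN]] := @eventually_avoid _ X R (@unit_lebesgue R)
  (self_return dl) return_scale a C (4 / dl) n.
- by move=> j u; exact: measurable_self_return.
- by move=> j u v uv x [h1 h2 h3 h4]; split=> //; exact: le_trans uv.
- exact: hC.
- by move=> j; exact: powR_ge0.
- by rewrite divr_ge0//; lra.
- move=> j nj; rewrite mulrAC lam_self_return//; first exact: powR_ge0.
  by apply: le_trans hn; exact: (a_nonincr alpha0 alpha1).
- by move=> i j ij; exact: (a_nonincr alpha0 alpha1).
- move=> j; have mI : measurable (\bigcap_k self_return dl j (a k)).
    by apply: bigcapT_measurable => k; exact: measurable_self_return.
  rewrite -[LHS]fineK ?fin_num_measure//; congr _%:E.
  have [->|j0] := posnP j.
    rewrite (_ : \bigcap_k _ = set0) ?measure0//.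
    by apply/seteqP; split=> // x /(_ 0%N Logic.I)[].
  apply/eqP; rewrite eq_le fine_measure_ge0 andbT -(lam_periodic dl0 j0).
  apply: fine_measure_le => //; first exact: measurable_self_return.
  move=> x hx; have [_ x01 dx _] := hx 0%N Logic.I; split=> //.
  apply/ler_addgt0Pr => e e0; rewrite add0r.
  have [k hk] := a_small alpha0 alpha1 e0.
  by have [_ _ _ h] := hx k Logic.I; exact: le_trans hk.
exists N; split=> //; first by rewrite N0.
by move=> x x01 xN; have [K hK] := hN _ xN; exists K.
Qed.

End NoReturn.
End GoodSets.

(** * Equidistribution of measurable sets *)
Section Equidistribution.
Context {R : realType} {alpha : R} (alpha0 : 0 < alpha) (alpha1 : alpha < 1).
Local Notation X := (measurableTypeR R).
Local Notation T := (T_alpha alpha).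
Local Notation g := (@left_inv R alpha).
Local Notation a := (@a_ R g).
Let gP : full_branch g := left_inv_full_branch alpha0 alpha1.
Implicit Types (x y c b : R) (n k : nat) (A B V : set X).

(** The bound is uniform in [n], as [pushn_tight] requires. *)
Lemma tail_a_small (e : R) : 0 < e ->
  exists q0, forall q n, (q0 <= q)%N -> \sum_(q <= k < q + n) a k <= e.
Proof.
move=> e0; have [C C0 hC] := sum_a_bounded alpha0 alpha1 alpha1.
have aP := a_gt0 alpha0 alpha1.
pose S n := \sum_(0 <= k < n) a k.
have SC n : S n <= C.
  by apply: le_trans (hC n); apply: ler_sum => j _; rewrite powRr1// ltW.
have hs : has_sup (range S).
  by split; [exists (S 0%N), 0%N|exists C => _ [n _ <-]].
have [_ [q0 _ <-] hq0] := sup_adherent e0 hs.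
exists q0 => q n q0q.
have -> : \sum_(q <= k < q + n) a k = S (q + n)%N - S q.
  by rewrite /S (@big_cat_nat _ _ _ q 0 (q + n))//= ?leq_addr// addrAC subrr add0r.
have : S (q + n)%N <= sup (range S) by apply: sup_upper_bound => //; exists (q + n)%N.
have : S q0 <= S q.
  rewrite /S (@big_cat_nat _ _ _ q0 0 q)//= lerDl sumr_ge0// => i _; exact: ltW.
lra.
Qed.

Definition equidistributed B := forall rho : R, 0 < rho -> exists M, forall M' V,
  (M <= M')%N -> measurable V ->
  `|lam (iter M' T @^-1` V `&` B) - lam B * lam (iter M' T @^-1` V)| <= rho.

(** The starting density is bounded by [b^-1], so the first term of [pushn_tight] is at
most [a (q + n) / b]. *)
Lemma ramp_tight b : 0 < b -> b <= 1 -> forall rho : R, 0 < rho ->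
  exists q0, forall q n, (q0 <= q)%N -> pushn (g := g) n (ramp 0 b) (a q) <= rho.
Proof.
move=> b0 b1 rho rho0.
have [q1 hq1] := tail_a_small (ltac:(lra) : 0 < rho / 2).
have [q2 hq2] := a_small alpha0 alpha1 (ltac:(nra) : 0 < b * rho / 2).
exists (maxn q1 q2) => q n; rewrite geq_max => /andP[q1q q2q].
have := pushn_tight gP n q (ramp_concave b0) (ramp_nondecreasing b0).
rewrite ramp0// ramp1// => /(_ erefl (lexx 1)).
have := hq1 q n q1q.
have aq := a_range gP (q + n).
have : ramp 0 b (a (q + n)) <= rho / 2.
  apply: (le_trans (ramp_le (lexx 0) b0 _)); first by case/andP: aq.
  rewrite ler_pdivrMr//.
  have := a_nonincr alpha0 alpha1 (leq_trans q2q (leq_addr n _)); lra.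
lra.
Qed.

Lemma preimage_iter_shift M M' V : (M <= M')%N ->
  iter M' T @^-1` V = iter M T @^-1` (iter (M' - M) T @^-1` V).
Proof.
by move=> h; apply/seteqP; split=> x /=; rewrite -iterD subnK.
Qed.

Lemma equidistributed_interval b : 0 < b -> b <= 1 ->
  equidistributed `[0, b[%classic.
Proof.
move=> b0 b1 rho rho0.
have rho2 : 0 < rho / 2 by lra.
have [q1 hq1] := ramp_tight b0 b1 rho2.
have [q2 hq2] := ramp_tight ltr01 (lexx 1) rho2.
pose q := maxn q1 q2.
have [M hM] := equilibration alpha0 alpha1 q rho0.
exists M => M' V MM' mV.
rewrite (preimage_iter_shift V MM').
have : measurable (iter (M' - M) T @^-1` V) by exact: measurable_iter_preimage.
set W := iter (M' - M) T @^-1` V => mW.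
have mTW : measurable (iter M T @^-1` W) by exact: measurable_iter_preimage.
have [m1 [c1 m1E d1]] := uniform_measure (lexx 0) b0 b1.
have [m2 [c2 m2E d2]] := uniform_measure (lexx 0) ltr01 (lexx (1 : R)).
have := hM m1 m2 (ramp 0 b) (ramp 0 1).
move=> h; have {h} := h _ _ W mW; rewrite m1E// m2E// !subr0 divr1.
rewrite -(carried_by_unitE (@lam_carried R))// lam_itv ?subr0; [|lra..].
move=> h; have {}h : `|lam (iter M T @^-1` W `&` `[0, b[%classic) / b
    - lam (iter M T @^-1` W)| <= rho.
  apply: h; split=> //.
  - by exists (b - 0)^-1; [rewrite invr_ge0; lra|exact: ramp_lipschitz].
  - split; [exact: ramp_concave|exact: ramp_nondecreasing|exact: ramp0|exact: ramp1|].
    by move=> n; apply: hq1; rewrite leq_maxl.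
  - by exists (1 - 0)^-1; [rewrite invr_ge0; lra|exact: ramp_lipschitz].
  - split; [exact: ramp_concave|exact: ramp_nondecreasing|exact: ramp0|exact: ramp1|].
    by move=> n; apply: hq2; rewrite leq_maxr.
have -> : lam (iter M T @^-1` W `&` `[0, b[%classic) - b * lam (iter M T @^-1` W)
   = b * (lam (iter M T @^-1` W `&` `[0, b[%classic) / b - lam (iter M T @^-1` W)).
  by field; lra.
rewrite normrM (gtr0_norm b0); apply: le_trans h.
by rewrite ler_piMl.
Qed.

Lemma equidistributed_ray x : equidistributed `]-oo, x[%classic.
Proof.
have mray : measurable (`]-oo, x[%classic : set X) by exact: measurable_itv.
have rayE A : measurable A -> lam (A `&` `]-oo, x[%classic) =
    lam (A `&` `[0, clamp x[%classic).
  move=> mA; have mI := measurableI _ _ mA mray.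
  have mJ : measurable (A `&` `[0, clamp x[%classic) by apply: measurableI.
  rewrite (carried_by_unitE (@lam_carried R))//.
  rewrite [RHS](carried_by_unitE (@lam_carried R))//; congr (lam _).
  have [x0|x0] := leP x 0.
    rewrite [clamp x]max_l; last by rewrite ge_min x0 orbT.
    by apply/seteqP; split=> y [[Ay /=]]; rewrite !in_itv/= => h1 h2; exfalso; lra.
  rewrite [clamp x]max_r; last by rewrite le_min; lra.
  apply/seteqP; split=> y [[Ay /=]]; rewrite !in_itv/= => h1 h2.
    by do 2!split=> //=; rewrite ?lt_min; lra.
  by move: h1; rewrite lt_min => h1; do 2!split=> //=; lra.
have [cx0|cx0] := leP (clamp x) 0; last first.
  have := equidistributed_interval cx0 (proj2 (andP (clamp_range x))).
  move=> h rho /h[M hM]; exists M => M' V MM' mV.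
  have := hM M' V MM' mV; rewrite -rayE; last exact: measurable_iter_preimage.
  by have := rayE setT measurableT; rewrite !setTI => ->.
move=> rho rho0; exists 0%N => M' V _ mV.
have -> : lam (`]-oo, x[%classic : set X) = 0.
  have := rayE setT measurableT; rewrite !setTI => ->.
  by rewrite set_itv_ge ?measure0// bnd_simp -leNgt.
rewrite rayE; last exact: measurable_iter_preimage.
rewrite [`[0, clamp x[%classic]set_itv_ge ?bnd_simp -?leNgt//.
by rewrite setI0 measure0/= mul0r subrr normr0 ltW.
Qed.

(** The half-lines form a pi-system, and the sets that equidistribute a lambda-system:
a countable increasing union is approximated in measure by one of its terms,
at a cost that is uniform in [V]. *)
Lemma equidistributed_measurable B : measurable B -> equidistributed B.
Proof.
pose H : set (set X) := [set B | measurable B /\ equidistributed B].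
suff sub : <<s @RGenInftyO.G R >> `<=` H.
  move=> mB; have [] // := sub B.
  have : (@ocitv R).-sigma.-measurable B by exact: mB.
  by rewrite RGenInftyO.measurableE.
clear B; apply: lambda_system_subset => //.
- move=> _ _ [x ->] [y ->]; exists (Num.min x y).
  apply/seteqP; split=> z /=; rewrite !in_itv/= lt_min; first by move=> [-> ->].
  by move/andP.
- split=> //.
  + split=> // rho rho0; exists 0%N => M' V _ mV.
    by rewrite setIT lam1 mul1r subrr normr0 ltW.
  + move=> A B BA [mA eA] [mB eB]; split; first exact: measurableD.
    move=> rho rho0; have rho2 : 0 < rho / 2 by lra.
    have [M1 h1] := eA _ rho2; have [M2 h2] := eB _ rho2.
    exists (maxn M1 M2) => M' V; rewrite geq_max => /andP[M1M' M2M'] mV.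
    have mW : measurable (iter M' T @^-1` V) by exact: measurable_iter_preimage.
    have := h1 M' V M1M' mV; have := h2 M' V M2M' mV.
    set W := iter M' T @^-1` V in mW *.
    have := fine_measure_split (@unit_lebesgue R) mA mB.
    have := fine_measure_split (@unit_lebesgue R) (measurableI _ _ mW mA) mB.
    rewrite -setIA (setIidr BA) -setIDA => -> ->.
    move=> /ler_normlP[? ?] /ler_normlP[? ?]; rewrite ler_norml; lra.
  + move=> F ndF HF; have mF n : measurable (F n) by have [] := HF n.
    have mU : measurable (\bigcup_n F n) by exact: bigcupT_measurable.
    split=> // rho rho0; have rho4 : 0 < rho / 4 by lra.
    have cF : fine (unit_lebesgue (F n)) @[n --> \oo] --> lam (\bigcup_n F n).
      apply: fine_cvg; rewrite fineK ?fin_num_measure//.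
      exact: nondecreasing_cvg_mu.
    have [n hn] : exists n, lam (\bigcup_n F n) - lam (F n) <= rho / 4.
      move/cvgrPdist_le : cF => /(_ _ rho4)[n _ /(_ n (leqnn n))] /ler_normlP[_ h].
      by exists n.
    have [M hM] := (HF n).2 _ rho4.
    exists M => M' V MM' mV; have := hM M' V MM' mV.
    have mW : measurable (iter M' T @^-1` V) by exact: measurable_iter_preimage.
    set W := iter M' T @^-1` V in mW *; set U := \bigcup_n F n in hn mU *.
    have FU : F n `<=` U by move=> x Fx; exists n.
    have := fine_measure_split (@unit_lebesgue R) (measurableI _ _ mW mU) (mF n).
    rewrite -setIA (setIidr FU) -setIDA => e1.
    have := fine_measure_split (@unit_lebesgue R) mU (mF n); rewrite (setIidr FU) => e2.
    have l1 : lam (W `&` (U `\` F n)) <= lam (U `\` F n).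
      have mD := measurableD mU (mF n).
      by apply: fine_measure_le => //; exact: measurableI.
    have l0 := fine_measure_ge0 (@unit_lebesgue R) (W `&` (U `\` F n)).
    have lW1 := lam_le1 mW; have lW0 := fine_measure_ge0 (@unit_lebesgue R) W.
    have p1 : 0 <= lam (U `\` F n) * lam W.
      by rewrite mulr_ge0// fine_measure_ge0.
    have p2 : lam (U `\` F n) * lam W <= lam (U `\` F n) * 1.
      by rewrite ler_wpM2l// fine_measure_ge0.
    move=> /ler_normlP[? ?]; rewrite ler_norml e1 e2; lra.
- move=> _ [x ->]; split; first exact: measurable_itv.
  exact: equidistributed_ray.
Qed.

End Equidistribution.

(** * The density of the invariant measure *)
Section Density.
Context {R : realType}.
Local Notation X := (measurableTypeR R).
Local Notation leb := (@lebesgue_measure R).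
Variable mu : probability X R.
Hypothesis mu_carrier : mu `[0, 1]%classic = 1%E.
Hypothesis mu_ac : mu `<< leb.
Implicit Types (A B C V : set X).

Lemma density_exists : exists h : R -> R, [/\ measurable_fun [set: X] h,
  leb.-integrable setT (EFin \o h) &
  forall A, measurable A -> mu A = (\int[leb]_(x in A) (h x)%:E)%E].
Proof.
pose nu := charge_of_finite_measure mu.
have numu : nu `<< leb by [].
pose f := Radon_Nikodym nu leb.
have ff x : f x \is a fin_num by exact: Radon_Nikodym_fin_num.
have fE : EFin \o (fine \o f) = f by apply/funext => x /=; rewrite fineK.
have intf : leb.-integrable setT f by exact: Radon_Nikodym_integrable.
exists (fine \o f); split; last 2 first.
- by rewrite fE.
- move=> A mA; have := Radon_Nikodym_integral numu mA; rewrite -/f -fE.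
  by move=> <-.
by apply/measurable_EFinP; rewrite fE; exact: measurable_int intf.
Qed.

Lemma mu_null A : measurable A -> leb A = 0%E -> mu A = 0%E.
Proof.
by move=> mA h; apply/(measure0_null_setP mu mA)/mu_ac/(measure0_null_setP leb mA).
Qed.

Lemma mu_carried : carried_by_unit mu.
Proof.
have mI : measurable (`[0, 1]%classic : set X) by exact: measurable_itv.
have mJ : measurable (`[0, 1[%classic : set X) by exact: measurable_itv.
have m1 : measurable ([set 1] : set X) by exact: measurable_set1.
have n1 : mu [set 1] = 0%E by apply: mu_null => //; exact: lebesgue_measure_set1.
have n2 : mu (~` `[0, 1]%classic) = 0%E.
  by rewrite probability_setC// mu_carrier subee.
rewrite /carried_by_unit; apply: (measure_negligible (measurableC mJ)).
apply: (@negligibleS _ _ _ mu (~` `[0, 1]%classic `|` [set 1])).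
  move=> x /= h; have [->|x1] := eqVneq x 1; [by right|left => h'; apply: h].
  by move: h'; rewrite /= !in_itv/= => /andP[-> h]; rewrite lt_neqAle x1.
apply: negligibleU; first by exists (~` `[0, 1]%classic); split => //; exact: measurableC.
by exists [set 1]; split.
Qed.

Variable h : R -> R.
Hypothesis mh : measurable_fun [set: X] h.
Hypothesis ih : leb.-integrable setT (EFin \o h).
Hypothesis hE : forall A, measurable A -> mu A = (\int[leb]_(x in A) (h x)%:E)%E.

Lemma integrable_cst_bounded A (p : R) : measurable A -> (leb A < +oo)%E ->
  leb.-integrable A (EFin \o cst p).
Proof.
move=> mA fA; apply/integrableP; split.
  by apply/measurable_EFinP; exact: measurable_cst.
rewrite /= (integral_cst _ mA) lte_mul_pinfty//; exact: lee_fin.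
Qed.

Lemma measurable_level (p q : R) : measurable [set x : X | p <= h x < q].
Proof.
rewrite (_ : [set x | _] = h @^-1` `[p, q[%classic).
  by rewrite -[X in measurable X]setTI; apply: mh => //; exact: measurable_itv.
by apply/seteqP; split=> x /=; rewrite in_itv.
Qed.

Lemma fine_unit_lebesgue C : C `<=` `[0, 1[%classic -> unit_lebesgue C = leb C.
Proof. by move=> C01; rewrite unit_lebesgueE (setIidl C01). Qed.

Let integral_cst_unit (s : R) C : measurable C -> C `<=` `[0, 1[%classic ->
  leb.-integrable C (EFin \o cst s) /\
  (\int[leb]_(x in C) (cst s x)%:E)%E = (s * lam C)%:E.
Proof.
move=> mC C01; have fC : (leb C < +oo)%E.
  by rewrite -fine_unit_lebesgue// ltey_eq fin_num_measure.
split; first exact: integrable_cst_bounded.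
transitivity (\int[leb]_(x in C) cst s%:E x)%E; first by [].
by rewrite integral_cst// EFinM fineK ?fin_num_measure// fine_unit_lebesgue.
Qed.

Lemma density_ge (p : R) C : measurable C -> C `<=` `[0, 1[%classic ->
  (forall x, C x -> p <= h x) -> p * lam C <= fine (mu C).
Proof.
move=> mC C01 hC; have [ip cE] := integral_cst_unit p mC C01.
have ihC : leb.-integrable C (EFin \o h) by apply: integrableS ih.
rewrite -lee_fin fineK ?fin_num_measure// hE// -cE.
by apply: le_integral => // x; rewrite inE => /hC ?; rewrite lee_fin.
Qed.

Lemma density_le (q : R) C : measurable C -> C `<=` `[0, 1[%classic ->
  (forall x, C x -> h x <= q) -> fine (mu C) <= q * lam C.
Proof.
move=> mC C01 hC; have [iq cE] := integral_cst_unit q mC C01.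
have ihC : leb.-integrable C (EFin \o h) by apply: integrableS ih.
rewrite -lee_fin fineK ?fin_num_measure// hE// -cE.
by apply: le_integral => // x; rewrite inE => /hC ?; rewrite lee_fin.
Qed.

(** The mean of [|h - h z|] over the ball tends to 0, and [A] only selects a part of
the ball. *)
Lemma lebesgue_pt_ball (z e : R) : lebesgue_pt h z -> 0 < e ->
  exists2 r0, 0 < r0 & forall r, 0 < r -> r < r0 ->
    ball z r `<=` `[0, 1[%classic ->
    forall A, measurable A ->
    `|fine (mu (A `&` ball z r)) - h z * lam (A `&` ball z r)| <= e * r.
Proof.
move=> hz e0; have e20 : 0 < e / 2 by lra.
have /fine_cvgP[fz /cvgrPdist_le/(_ _ e20) cz] := hz.
have [d0 /= d00 hd0] : \forall r \near 0^'+, (davg h z r <= (e / 2)%:E)%E.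
  apply: filterS2 fz cz => r fr; rewrite sub0r normrN => cr.
  by rewrite -(fineK fr) lee_fin; exact: le_trans (ler_norm _) cr.
exists d0 => // r r0 rd U01 A mA; set U := ball z r in U01 *.
have mU : measurable (U : set X) by exact: measurable_ball.
have mC : measurable (A `&` U) by exact: measurableI.
have C01 : A `&` U `<=` `[0, 1[%classic by move=> x [_ /U01].
have [iz cE] := integral_cst_unit (h z) mC C01.
have ihC D : measurable D -> leb.-integrable D (EFin \o h) by move=> mD; apply: integrableS ih.
have lU : leb U = (2 * r)%:E by rewrite lebesgue_measure_ball ?mulr_natl// ltW.
have dU : (\int[leb]_(y in U) `|(h y - h z)%:E| <= (e * r)%:E)%E.
  have := hd0 r; rewrite /ball/= sub0r normrN gtr0_norm// => /(_ rd r0).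
  rewrite /davg /iavg -/U lU inver gt_eqF; last lra.
  have r2 : 0 < (2 * r)^-1 by rewrite invr_gt0; lra.
  rewrite lee_pdivrMl; last lra.
  by rewrite -EFinM (_ : 2 * r * (e / 2) = e * r) //; lra.
have E : (\int[leb]_(y in A `&` U) ((h y)%:E - (h z)%:E))%E =
    (fine (mu (A `&` U)) - h z * lam (A `&` U))%:E.
  rewrite (integralB_EFin mC (ihC _ mC) iz) cE -hE//.
  by rewrite EFinB fineK ?fin_num_measure.
rewrite -lee_fin; apply: le_trans dU.
rewrite (_ : (`|_|)%:E = `|(fine (mu (A `&` U)) - h z * lam (A `&` U))%:E|%E)// -E.
have mD D : measurable D -> measurable_fun D (fun y : X => ((h y)%:E - (h z)%:E)%E).
  move=> mD; apply/measurable_EFinP; apply: measurable_funB => //.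
  exact: measurable_funS mh.
apply: (le_trans (le_abse_integral _ mC (mD _ mC))).
apply: ge0_subset_integral => //.
by apply: measurableT_comp => //; exact: mD.
Qed.

End Density.

Section InvariantDensity.
Context {R : realType} {alpha : R} (alpha0 : 0 < alpha) (alpha1 : alpha < 1).
Local Notation X := (measurableTypeR R).
Local Notation T := (T_alpha alpha).
Local Notation g := (@left_inv R alpha).
Local Notation a := (@a_ R g).
Local Notation leb := (@lebesgue_measure R).
Variable mu : probability X R.
Hypothesis mu_carrier : mu `[0, 1]%classic = 1%E.
Hypothesis mu_ac : mu `<< leb.
Hypothesis mu_inv : invariant_measure T mu.
Let gP : full_branch g := left_inv_full_branch alpha0 alpha1.
Implicit Types (x y z : R) (n k : nat) (A B C V : set X).

Variable h : R -> R.
Hypothesis mh : measurable_fun [set: X] h.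
Hypothesis ih : leb.-integrable setT (EFin \o h).
Hypothesis hE : forall A, measurable A -> mu A = (\int[leb]_(x in A) (h x)%:E)%E.

Definition mixes_within A (e : R) := exists M, forall M' V, (M <= M')%N ->
  measurable V ->
  `|fine (mu (iter M' T @^-1` V `&` A)) - fine (mu A) * lam (iter M' T @^-1` V)| <= e.

Let m01 : measurable (`[0, 1[%classic : set X). Proof. exact: measurable_unit. Qed.

Let level (p q : R) : set X := [set x | p <= h x < q] `&` `[0, 1[%classic.

Let mlevel p q : measurable (level p q).
Proof. by apply: measurableI => //; exact: measurable_level. Qed.

(** On the set where [p <= h < q] the measure [mu] is [p * lam] up to [q - p], and
[lam] restricted to this set equidistributes. *)
Lemma mixes_within_level (p q rho : R) : 0 <= p -> p <= q -> 0 < rho ->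
  mixes_within (level p q) (2 * (q - p) * lam (level p q) + rho).
Proof.
move=> p0 pq rho0; have r1 : 0 < rho / (p + 1) by rewrite divr_gt0//; lra.
have [M hM] := equidistributed_measurable alpha0 alpha1 (mlevel p q) r1.
exists M => M' V MM' mV; have := hM M' V MM' mV.
set W := iter M' T @^-1` V; set B := level p q.
have mW : measurable W by exact: measurable_iter_preimage.
have mB : measurable B by exact: mlevel.
have mWB : measurable (W `&` B) by exact: measurableI.
have B01 : B `<=` `[0, 1[%classic by move=> x [].
have WB01 : W `&` B `<=` `[0, 1[%classic by move=> x [_ /B01].
have hp x : B x -> p <= h x by move=> [/= /andP[]].
have hq x : B x -> h x <= q by move=> [/= /andP[_ /ltW]].
have b1 := density_ge ih hE mB B01 hp.
have b2 := density_le ih hE mB B01 hq.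
have b3 := density_ge ih hE mWB WB01 (fun x hx => hp x hx.2).
have b4 := density_le ih hE mWB WB01 (fun x hx => hq x hx.2).
have lWB : lam (W `&` B) <= lam B by apply: fine_measure_le => // x [].
have lW0 := fine_measure_ge0 (@unit_lebesgue R) W; have lW1 := lam_le1 mW.
have k1 : (q - p) * lam (W `&` B) <= (q - p) * lam B by rewrite ler_wpM2l//; lra.
have k2 : 0 <= (fine (mu B) - p * lam B) * lam W by rewrite mulr_ge0//; lra.
have k3 : (fine (mu B) - p * lam B) * lam W <= (fine (mu B) - p * lam B) * 1.
  by rewrite ler_wpM2l//; lra.
move=> /ler_normlP[e1 e2].
have pr : p * (rho / (p + 1)) <= rho.
  by rewrite mulrCA ger_pMr// ler_pdivrMr; lra.
have f1 : p * (- (lam (W `&` B) - lam B * lam W)) <= p * (rho / (p + 1)).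
  by rewrite ler_wpM2l.
have f2 : p * (lam (W `&` B) - lam B * lam W) <= p * (rho / (p + 1)).
  by rewrite ler_wpM2l.
by rewrite ler_norml; apply/andP; split; lra.
Qed.

Lemma mixes_withinU A B (e f : R) : measurable A -> measurable B ->
  A `&` B = set0 -> mixes_within A e -> mixes_within B f ->
  mixes_within (A `|` B) (e + f).
Proof.
move=> mA mB AB [M1 h1] [M2 h2]; exists (maxn M1 M2) => M' V.
rewrite geq_max => /andP[M1M' M2M'] mV.
have mW : measurable (iter M' T @^-1` V) by exact: measurable_iter_preimage.
have := h1 M' V M1M' mV; have := h2 M' V M2M' mV.
set W := iter M' T @^-1` V in mW *.
have mWA : measurable (W `&` A) by exact: measurableI.
have mWB : measurable (W `&` B) by exact: measurableI.
have d : (W `&` A) `&` (W `&` B) = set0 by rewrite setIACA AB setI0.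
rewrite setIUr (fine_measureU mu mA mB AB) (fine_measureU mu mWA mWB d).
move=> /ler_normlP[? ?] /ler_normlP[? ?].
by rewrite ler_norml; apply/andP; split; lra.
Qed.

Let below (q : R) : set X := [set x | h x < q] `&` `[0, 1[%classic.

Let mbelow q : measurable (below q).
Proof.
apply: measurableI => //.
rewrite (_ : [set x | _] = h @^-1` `]-oo, q[%classic).
  by rewrite -[X in measurable X]setTI; apply: mh => //; exact: measurable_itv.
by apply/seteqP; split=> x /=; rewrite in_itv.
Qed.

Lemma measurable_density_nonpos :
  measurable ([set x | h x <= 0] `&` `[0, 1[%classic : set X).
Proof.
apply: measurableI => //; rewrite (_ : [set x | _] = h @^-1` `]-oo, 0]%classic).
  by rewrite -[X in measurable X]setTI; apply: mh => //; exact: measurable_itv.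
by apply/seteqP; split=> x /=; rewrite in_itv.
Qed.

Lemma density_nonpos : fine (mu ([set x | h x <= 0] `&` `[0, 1[%classic)) = 0.
Proof.
have mN := measurable_density_nonpos.
apply/eqP; rewrite eq_le fine_measure_ge0 andbT.
have := density_le ih hE mN (@subIsetr _ _ _) (q := 0).
by rewrite mul0r; apply => x [].
Qed.

Lemma mixes_within_below (eta rho : R) n : 0 < eta -> 0 < rho ->
  mixes_within (below (n%:R * eta)) (2 * eta * lam (below (n%:R * eta)) + n%:R * rho).
Proof.
move=> eta0 rho0; elim: n => [|n ihn].
  rewrite !mul0r addr0; exists 0%N => M' V _ mV.
  have mW : measurable (iter M' T @^-1` V) by exact: measurable_iter_preimage.
  have b0 : fine (mu (below 0)) = 0.
    apply/eqP; rewrite eq_le fine_measure_ge0 andbT -[leRHS]density_nonpos.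
    apply: fine_measure_le => //; last by move=> x [/= /ltW ? ?].
    exact: measurable_density_nonpos.
  have : fine (mu (iter M' T @^-1` V `&` below 0)) <= fine (mu (below 0)).
    by apply: fine_measure_le => //; exact: measurableI.
  have := fine_measure_ge0 mu (iter M' T @^-1` V `&` below 0).
  have : 0 <= 2 * eta * lam (below 0) by rewrite mulr_ge0 ?fine_measure_ge0//; lra.
  by rewrite b0 mul0r subr0 ler_norml => ? ? ?; lra.
have nS : n.+1%:R * eta = n%:R * eta + eta by rewrite -[n.+1]addn1 natrD; lra.
have ne0 : 0 <= n%:R * eta by rewrite mulr_ge0//; lra.
have disj : below (n%:R * eta) `&` level (n%:R * eta) (n.+1%:R * eta) = set0.
  apply/seteqP; split=> // x [[/= h1 _] [/= /andP[h2 _] _]]; lra.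
have U : below (n.+1%:R * eta) =
    below (n%:R * eta) `|` level (n%:R * eta) (n.+1%:R * eta).
  apply/seteqP; split=> x.
    move=> [/= h1 h2]; have [h3|h3] := ltP (h x) (n%:R * eta); [by left|right].
    by split=> //=; rewrite h3.
  move=> [[h1 h2]|[/andP[h1 h2] h3]]; split=> //.
  have {}h1 : h x < n%:R * eta := h1.
  have : h x < n.+1%:R * eta by rewrite nS; lra.
  by [].
have nSle : n%:R * eta <= n.+1%:R * eta by rewrite nS; lra.
have ml := mixes_within_level ne0 nSle rho0.
have E : 2 * eta * lam (below (n%:R * eta)) + n%:R * rho +
    (2 * (n.+1%:R * eta - n%:R * eta) *
       lam (level (n%:R * eta) (n.+1%:R * eta)) + rho) =
    2 * eta * lam (below (n.+1%:R * eta)) + n.+1%:R * rho.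
  rewrite U (fine_measureU _ (mbelow _) (mlevel _ _) disj).
  by rewrite nS -[n.+1]addn1 natrD; lra.
by rewrite -E U; exact: mixes_withinU.
Qed.

(** [mu V = mu (T^-n V)], and [mu] is a sum of almost constant multiples of [lam] over
the level sets of [h], up to the small set where [h] is large. *)
Lemma mu_equidistribution (rho : R) : 0 < rho -> exists M, forall M' V,
  (M <= M')%N -> measurable V -> `|fine (mu V) - lam (iter M' T @^-1` V)| <= rho.
Proof.
move=> rho0; pose eta := rho / 8.
have eta0 : 0 < eta by rewrite /eta; lra.
have r4 : 0 < rho / 4 by lra.
have mu01 : fine (mu `[0, 1[%classic) = 1.
  have := carried_by_unitE (mu_carried mu_carrier mu_ac) (@measurableT _ X).
  by rewrite setTI /= probability_setT => <-.
have cF : fine (mu (below (n%:R * eta))) @[n --> \oo] --> (1 : R).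
  rewrite -[X in _ --> X]mu01; apply: fine_cvg; rewrite fineK ?fin_num_measure//.
  have -> : `[0, 1[%classic = \bigcup_n below (n%:R * eta).
    apply/seteqP; split=> [x x01|x [n _ []]//].
    exists (Num.bound (`|h x| / eta)) => //; split=> //=.
    have := archi_boundP (divr_ge0 (normr_ge0 (h x)) (ltW eta0)).
    by rewrite ltr_pdivrMr// => /(le_lt_trans (ler_norm _)).
  apply: (nondecreasing_cvg_mu (F := fun n => below (n%:R * eta))) => //.
    exact: bigcupT_measurable.
  move=> i j ij; apply/subsetPset => x [/= h1 h2]; split=> //=.
  by apply: (lt_le_trans h1); rewrite ler_wpM2r ?ler_nat// ltW.
have [n hn] : exists n, 1 - fine (mu (below (n%:R * eta))) <= rho / 4.
  move/cvgrPdist_le : cF => /(_ _ r4)[n _ /(_ n (leqnn n))] /ler_normlP[_ hn].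
  by exists n.
have n10 : 0 < n%:R + 1 :> R by rewrite ltr_wpDl.
have r4n : 0 < rho / 4 / (n%:R + 1) by rewrite divr_gt0.
have [M hM] := mixes_within_below n eta0 r4n.
exists M => M' V MM' mV; have := hM M' V MM' mV.
set W := iter M' T @^-1` V; set A := below _ in hn *.
have mA : measurable A by exact: mbelow.
have mW : measurable W by exact: measurable_iter_preimage.
have -> : fine (mu V) = fine (mu W).
  by rewrite (measure_preimage_iter (@measurable_T R alpha) mu_inv).
have := fine_measure_split mu mW mA.
have : fine (mu (W `\` A)) <= 1 - fine (mu A).
  have := fine_measure_split mu (@measurableT _ X) mA.
  rewrite /= probability_setT setTI setTD /= => e.
  have : fine (mu (W `\` A)) <= fine (mu (~` A)).
    apply: fine_measure_le; [exact: measurableD|exact: measurableC|by move=> x []].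
  by rewrite /= in e *; lra.
have := fine_measure_ge0 mu (W `\` A).
have lA := lam_le1 mA; have lA0 := fine_measure_ge0 (@unit_lebesgue R) A.
have lW0 := fine_measure_ge0 (@unit_lebesgue R) W; have lW1 := lam_le1 mW.
have eA : 2 * eta * lam A <= rho / 4.
  have : 2 * eta * lam A <= 2 * eta * 1 by rewrite ler_wpM2l//; lra.
  by rewrite /eta; lra.
have eN : n%:R * (rho / 4 / (n%:R + 1)) <= rho / 4.
  by rewrite mulrCA ger_pMr// ler_pdivrMr//; lra.
have q0 : 0 <= 1 - fine (mu A).
  rewrite subr_ge0.
  have := fine_measure_le mu mA (@measurableT _ X) (@subsetT _ _).
  by rewrite /= probability_setT.
have p1 : 0 <= (1 - fine (mu A)) * lam W by rewrite mulr_ge0.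
have p2 : (1 - fine (mu A)) * lam W <= (1 - fine (mu A)) * 1 by rewrite ler_wpM2l.
move=> q1 q2 q3 /ler_normlP[q4 q5].
by rewrite ler_norml; apply/andP; split; lra.
Qed.

End InvariantDensity.

(** * Mixing of the uniform law on a ball *)
Section LocalMixing.
Context {R : realType} {alpha : R} (alpha0 : 0 < alpha) (alpha1 : alpha < 1).
Local Notation X := (measurableTypeR R).
Local Notation T := (T_alpha alpha).
Local Notation g := (@left_inv R alpha).
Local Notation a := (@a_ R g).
Local Notation leb := (@lebesgue_measure R).
Let gP : full_branch g := left_inv_full_branch alpha0 alpha1.
Implicit Types (x y z : R) (n k : nat) (A B C V : set X).

(** The interval [[w, b[] is shortened to [[w', b[], where [w'] is an end point of a
cylinder of level [k].  After [k] steps the law is concave; after [k] further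
steps it is tight at the scale of the fixed level [q], because by
[pushn_tight] the mass of [[0, a q]] from then on is at most the mass of
[[0, a k]] at time [k] plus a tail of the sum of the [a j].  The last [M']
steps mix. *)
Lemma interval_mixing (rho : R) : 0 < rho -> exists M, forall M' k w b V,
  (M <= M')%N -> 0 <= w < 1 -> w + a k < b -> b <= 1 -> measurable V ->
  (forall w', w <= w' <= w + a k ->
    lam (iter k T @^-1` `[0, a k[%classic `&` `[w', b[%classic) <= rho / 4 * (b - w')) ->
  exists2 w', w <= w' <= w + a k &
  `|lam (iter (M' + (k + k)) T @^-1` V `&` `[w', b[%classic)
      - (b - w') * lam (iter M' T @^-1` V)| <= rho * (b - w').
Proof.
move=> rho0; have rho2 : 0 < rho / 2 by lra.
have rho4 : 0 < rho / 4 by lra.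
have [q1 hq1] := tail_a_small alpha0 alpha1 rho4.
have [q2 hq2] := ramp_tight alpha0 alpha1 ltr01 (lexx 1) rho2.
pose q := maxn q1 q2.
have [M hM] := equilibration alpha0 alpha1 q rho0.
exists M => M' k w b V MM' w01 wb b1 mV tight.
have ak := a_range gP k.
have [w' [ww' w'a w'1 hw']] := cylinder_endpoint gP k w01.
have w'b : w' < b by lra.
have w'0 : 0 <= w' by lra.
exists w'; first lra.
have tightk := tight w' ltac:(lra).
have [m [cm mE dm]] := uniform_measure w'0 w'b b1.
have [m1 m1E] := image_finite_measure m (measurable_iter (alpha := alpha) (k + k)).
have cm1 := carried_image alpha0 alpha1 cm m1E.
pose F := pushn (g := g) k (ramp w' b).
have nr : nondecreasing_on w' (ramp w' b).
  by move=> x y x0 xy y1; apply: (ramp_nondecreasing w'b) => //; lra.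
have [cF nF] : concave_on 0 F /\ nondecreasing_on 0 F.
  apply: hw' => //; last exact: ramp_concave.
  by move=> x /andP[_ xw]; exact: ramp_low.
have F0 : F 0 = 0 by rewrite /F (pushn0 gP) ramp0.
have F1 : F 1 = 1 by rewrite /F (pushn1 gP) ramp1.
have mitv (i : interval R) : measurable ([set` i] : set X) by exact: measurable_itv.
have Fak : F (a k) <= rho / 4.
  rewrite /F -(cdf_iter alpha0 alpha1 _ dm)// mE; last exact: measurable_iter_preimage.
  by rewrite ler_pdivrMr//; lra.
have dm1 : left_cdf m1 (pushn (g := g) k F).
  move=> x x01; rewrite m1E (cdf_iter alpha0 alpha1 _ dm)//.
  by rewrite /F -pushnD.
have [m2 [c2 m2E d2]] := uniform_measure (lexx 0) ltr01 (lexx (1 : R)).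
have bw : 0 < b - w' by lra.
have bwV : 0 <= (b - w')^-1 by rewrite invr_ge0; lra.
have [L L0 lF] := pushn_lipschitz gP (k + k) bwV (ramp_lipschitz w'b).
pose V1 := iter (M' - M) T @^-1` V.
have mV1 : measurable V1 by exact: measurable_iter_preimage.
have mTV1 : measurable (iter M T @^-1` V1) by exact: measurable_iter_preimage.
have := hM m1 m2 (pushn (g := g) k F) (ramp 0 1).
move=> H; have {H} := H _ _ V1 mV1.
rewrite m1E mE; last by apply: measurable_iter_preimage.
rewrite m2E// subr0 divr1 -(carried_by_unitE (@lam_carried R))//.
rewrite -(preimage_iter_shift V MM').
have -> : iter (k + k) T @^-1` (iter M' T @^-1` V) = iter (M' + (k + k)) T @^-1` V.
  by apply/seteqP; split=> x /=; rewrite (iterD M').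
set lW := lam (_ `&` `[w', b[%classic); set lV := lam (iter M' T @^-1` V) => H.
have {}H : `|lW / (b - w') - lV| <= rho.
  apply: H; split=> //.
  - by exists L => //; rewrite /F -pushnD.
  - split; [exact: pushn_concave|exact: pushn_nondecreasing| | |].
    + by rewrite (pushn0 gP).
    + by rewrite (pushn1 gP).
    + move=> n; rewrite -pushnD.
      have := pushn_tight gP (n + k) q cF nF F0.
      rewrite F1 => /(_ (lexx 1)) H1.
      have H2 := hq1 q (n + k)%N (leq_maxl _ _).
      have H3 : F (a (q + (n + k))) <= F (a k).
        have r1 := a_range gP (q + (n + k)).
        apply: nF; [lra| |lra].
        by apply: (a_nonincr alpha0 alpha1); rewrite addnA leq_addl.
      lra.
  - by exists (1 - 0)^-1; [rewrite invr_ge0; lra|exact: ramp_lipschitz].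
  - split; [exact: ramp_concave|exact: ramp_nondecreasing|exact: ramp0|exact: ramp1|].
    by move=> n; apply: hq2; rewrite leq_maxr.
have -> : lW - (b - w') * lV = (b - w') * (lW / (b - w') - lV) by field; lra.
by rewrite normrM (gtr0_norm bw) mulrC ler_pM2r.
Qed.

Lemma ball_subset z r (x : R) : ball z r x <-> z - r < x < z + r.
Proof.
split; rewrite /ball/=; first by move=> /ltr_normlP[? ?]; lra.
by move=> h; rewrite ltr_norml; lra.
Qed.

(** The tightness required by [interval_mixing] is supplied by a set [G] of points
that are at distance at least [a k] from 0 at time [k] and that fills most of
the ball. *)
Lemma ball_mixing (eta : R) : 0 < eta -> eta <= 4^-1 ->
  exists M, forall M' k z r V G, (M <= M')%N -> 0 < r -> 0 <= z - r -> z + r <= 1 ->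
  a k <= eta * r -> measurable V -> measurable G ->
  (forall x, G x -> a k <= iter k T x) ->
  lam (ball z r `\` G) <= eta / 4 * r ->
  `|lam (iter (M' + (k + k)) T @^-1` V `&` ball z r)
      - 2 * r * lam (iter M' T @^-1` V)| <= 6 * (eta * r).
Proof.
move=> eta0 eta4; have [M hM] := interval_mixing eta0.
exists M => M' k z r V G MM' r0 zr0 zr1 akr mV mG hG lG.
(* The shift by [eta * r] keeps [[w', b[] inside the open ball. *)
pose b := z + r; pose w := z - r + eta * r.
have er0 : 0 < eta * r by rewrite mulr_gt0.
have er4 : eta * r <= 4^-1 * r by rewrite ler_pM2r.
have w01 : 0 <= w < 1 by rewrite /w; lra.
have wb : w + a k < b by rewrite /b /w; lra.
have b1 : b <= 1 by rewrite /b; lra.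
have mU : measurable (ball z r : set X) by exact: measurable_ball.
have [w' w'P hw'] : exists2 w', w <= w' <= w + a k &
    `|lam (iter (M' + (k + k)) T @^-1` V `&` `[w', b[%classic)
        - (b - w') * lam (iter M' T @^-1` V)| <= eta * (b - w').
  apply: (hM M' k w b V MM' w01 wb b1 mV) => w' w'P.
  apply: (@le_trans _ _ (lam (ball z r `\` G))).
    apply: fine_measure_le.
    - by apply: measurableI; [apply: measurable_iter_preimage|]; exact: measurable_itv.
    - exact: measurableD.
    - move=> x [/=]; rewrite !in_itv/= /b => xa xw.
      split; first by apply/ball_subset; rewrite /w in w'P; lra.
      by move=> /hG; lra.
  apply: (le_trans lG); rewrite ler_pM2l; last by rewrite divr_gt0.
  by rewrite /b; rewrite /w in w'P; lra.
have w'lo : z - r < w' by rewrite /w in w'P; lra.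
have w'hi : w' - (z - r) <= 2 * (eta * r) by rewrite /w in w'P; lra.
have w'b : w' < b by rewrite /b; lra.
clear w wb w'P w01 hM lG.
set W := iter (M' + (k + k)) T @^-1` V in hw' *.
have mW : measurable W by exact: measurable_iter_preimage.
have mWU : measurable (W `&` ball z r) by exact: measurableI.
have mW1 : measurable (`[w', b[%classic : set X) by exact: measurable_itv.
have W1U : `[w', b[%classic `<=` ball z r.
  by move=> x; rewrite /= in_itv/= /b => xw; apply/ball_subset; lra.
have t2 : lam (W `&` ball z r) - lam (W `&` `[w', b[%classic) <= 2 * (eta * r).
  have := fine_measure_split (@unit_lebesgue R) mWU mW1.
  rewrite -setIA (setIidr W1U) => ->; rewrite addrAC subrr add0r.
  apply: le_trans w'hi.
  have <- : lam (`[z - r, w'[%classic : set X) = w' - (z - r) by rewrite lam_itv; lra.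
  apply: fine_measure_le; [exact: measurableD|exact: measurable_itv|].
  move=> x [[_ /ball_subset xU]]; rewrite /= !in_itv/= /b => xw.
  apply/andP; split; first lra.
  by rewrite ltNge; apply/negP => wx; apply: xw; lra.
have t3 : lam (W `&` `[w', b[%classic) <= lam (W `&` ball z r).
  apply: fine_measure_le => //; first exact: measurableI.
  by move=> x [Wx /W1U].
have mMV : measurable (iter M' T @^-1` V) by exact: measurable_iter_preimage.
set lV := lam (iter M' T @^-1` V) in hw' *.
have lV0 : 0 <= lV := fine_measure_ge0 (@unit_lebesgue R) _.
have lV1 : lV <= 1 := lam_le1 mMV.
set lWU := lam _ in t2 t3 *; set lW1 := lam _ in t2 t3 hw'.
have be : eta * (b - w') <= eta * (2 * r) by rewrite ler_pM2l// /b; lra.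
have bl1 : (w' - (z - r)) * lV <= 2 * (eta * r) * 1.
  by apply: ler_pM => //; lra.
have bl0 : 0 <= (w' - (z - r)) * lV by rewrite mulr_ge0//; lra.
move: hw' => /ler_normlP[]; rewrite /b in be *; clear -t2 t3 be bl1 bl0 er0 => hw1 hw2.
by rewrite ler_norml; apply/andP; split; lra.
Qed.

End LocalMixing.

(** * Return times of small balls *)
(** The names stand for [m = mu U], [p = mu (W `&` U)], [q = mu V],
[l = lam (W `&` U)] and [v = lam (T^-M V)], where [U] is a ball of radius [r],
[H] the density of [mu] at its centre and [W = T^-N V].  Chaining the hypotheses
gives [p ~ H l ~ H (2 r) v ~ m v ~ m q]. *)
Lemma mixing_transfer (R : realFieldType) (H r eta m p q l v : R) :
  0 < H -> 0 < r -> 0 < eta -> H * r <= m -> 0 <= v <= 1 ->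
  `|m - H * (2 * r)| <= H * eta * r -> `|p - H * l| <= H * eta * r ->
  `|l - 2 * r * v| <= 6 * (eta * r) -> `|q - v| <= eta ->
  `|p - m * q| <= 9 * eta * m.
Proof.
move=> H0 r0 eta0 Hrm /andP[v0 v1] /ler_normlP[a1 a2] /ler_normlP[b1 b2].
move=> /ler_normlP[c1 c2] /ler_normlP[d1 d2].
have m0 : 0 < m by apply: lt_le_trans Hrm; rewrite mulr_gt0.
have K0 : 0 <= H * eta * r by rewrite !mulr_ge0// ltW.
have eHr : eta * (H * r) <= eta * m by rewrite ler_pM2l.
have mv1 : (m - H * (2 * r)) * v <= H * eta * r.
  apply: (@le_trans _ _ (H * eta * r * v)); first by rewrite ler_wpM2r//; lra.
  by rewrite ler_piMr.
have mv2 : (H * (2 * r) - m) * v <= H * eta * r.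
  apply: (@le_trans _ _ (H * eta * r * v)); first by rewrite ler_wpM2r//; lra.
  by rewrite ler_piMr.
have e1 : H * - (l - 2 * r * v) <= H * (6 * (eta * r)) by rewrite ler_pM2l.
have e2 : H * (l - 2 * r * v) <= H * (6 * (eta * r)) by rewrite ler_pM2l.
have f1 : m * - (q - v) <= m * eta by rewrite ler_pM2l.
have f2 : m * (q - v) <= m * eta by rewrite ler_pM2l.
by rewrite ler_norml; apply/andP; split; lra.
Qed.

Section SmallBalls.
Context {R : realType} {alpha : R} (alpha0 : 0 < alpha) (alpha1 : alpha < 1).
Local Notation X := (measurableTypeR R).
Local Notation T := (T_alpha alpha).
Local Notation g := (@left_inv R alpha).
Local Notation a := (@a_ R g).
Local Notation leb := (@lebesgue_measure R).
Let gP : full_branch g := left_inv_full_branch alpha0 alpha1.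
Implicit Types (x y z : R) (n k : nat) (A B C V : set X).

Variable mu : probability X R.
Hypothesis mu_carrier : mu `[0, 1]%classic = 1%E.
Hypothesis mu_ac : mu `<< leb.
Hypothesis mu_inv : invariant_measure T mu.
Variable h : R -> R.
Hypothesis mh : measurable_fun [set: X] h.
Hypothesis ih : leb.-integrable setT (EFin \o h).
Hypothesis hE : forall A, measurable A -> mu A = (\int[leb]_(x in A) (h x)%:E)%E.

Let theta : R := (1 + alpha) / 2.

Let th1 : alpha < theta. Proof. have al1 := alpha1; rewrite /theta; lra. Qed.
Let th2 : theta < 1. Proof. have al1 := alpha1; rewrite /theta; lra. Qed.

(** A return to the ball at time [j] would move [x] by less than [2 * r], while
[2 * r] is below the scale forbidden for every [j <= 4 * k]. *)
Lemma no_fast_return_avoids z (dl r : R) K k N : dl <= z - r ->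
  2 * r <= a K -> 2 * r <= a k `^ theta -> (N <= 4 * k)%N ->
  ball z r `&` no_fast_return (alpha := alpha) theta dl K `<=` avoids T (ball z r) N.
Proof.
move=> dlz rK rk Nk x [zx [x01 hx]] j /andP[j1 jN] zj.
have al1 := alpha1; have al0 := alpha0.
apply: (hx j); split=> //.
  by move: zj; rewrite /ball/= => /ltr_normlP[? ?]; lra.
have d : `|iter j T x - x| <= 2 * r.
  move: zx zj; rewrite /ball/= => /ltr_normlP[? ?] /ltr_normlP[? ?].
  by rewrite ler_norml; lra.
apply: (le_trans d); rewrite le_min rK andbT; apply: (le_trans rk).
rewrite /return_scale; apply: ge0_ler_powR.
- by rewrite /theta; lra.
- by rewrite nnegrE ltW// (a_gt0 alpha0 alpha1).
- by rewrite nnegrE ltW// (a_gt0 alpha0 alpha1).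
- by apply: (a_nonincr alpha0 alpha1); clear -jN Nk; lia.
Qed.

Lemma ball_return_error z r (H eta : R) G M N :
  0 < r -> 0 < H -> 0 < eta -> eta <= 4^-1 ->
  ball z r `<=` `[0, 1[%classic -> measurable G ->
  (forall A, measurable A ->
    `|fine (mu (A `&` ball z r)) - H * lam (A `&` ball z r)| <= H * eta * r) ->
  lam (ball z r `\` G) <= eta / 4 * r ->
  ball z r `&` G `<=` avoids T (ball z r) N ->
  (forall V, measurable V ->
    `|lam (iter N T @^-1` V `&` ball z r) - 2 * r * lam (iter M T @^-1` V)|
      <= 6 * (eta * r)) ->
  (forall V, measurable V -> `|fine (mu V) - lam (iter M T @^-1` V)| <= eta) ->
  N%:R * (3 * (H * r)) <= eta -> 3 * (H * r) <= eta ->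
  return_time_error T mu (ball z r) <= 26 * eta.
Proof.
move=> r0 H0 eta0 eta4 U01 mG hm lamUG GA mix equi Nr Hr3.
pose U : set R := ball z r; rewrite -/U in U01 hm lamUG GA mix *.
have mU : measurable (U : set X) by exact: measurable_ball.
have lamU : lam U = 2 * r.
  by rewrite fine_unit_lebesgue// lebesgue_measure_ball ?mulr_natl// ltW.
pose m := fine (mu U).
have hmU : `|m - H * (2 * r)| <= H * eta * r.
  by have := hm setT measurableT; rewrite setTI lamU.
have Hr0 : 0 < H * r by rewrite mulr_gt0.
have [Hrm m3] : H * r <= m /\ m <= 3 * (H * r).
  have : H * r * eta <= H * r * 4^-1 by rewrite ler_pM2l.
  by move: hmU => /ler_normlP[]; lra.
have m0 : 0 < m by exact: lt_le_trans Hrm.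
have short : fine (mu (U `\` avoids T U N)) <= 2 * eta * m.
  have mUG : measurable (U `\` G : set X) by exact: measurableD.
  have := hm _ mUG; rewrite setIidl; last by move=> x [].
  move=> /ler_normlP[_ s1].
  have s2 : fine (mu (U `\` avoids T U N)) <= fine (mu (U `\` G)).
    apply: fine_measure_le => //.
      by apply: measurableD => //; apply: measurable_avoids => //; exact: measurable_T.
    by move=> x [Ux xA]; split=> // xG; apply: xA; apply: GA.
  have s3 : H * lam (U `\` G) <= H * (eta / 4 * r) by rewrite ler_pM2l.
  have s4 : eta * (H * r) <= eta * m by rewrite ler_pM2l.
  have s5 : 0 < eta * (H * r) by rewrite mulr_gt0.
  by lra.
have mixing V : measurable V ->
    `|fine (mu (U `&` iter N T @^-1` V)) - m * fine (mu V)| <= 9 * eta * m.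
  move=> mV; rewrite setIC.
  have mMV : measurable (iter M T @^-1` V) by exact: measurable_iter_preimage.
  apply: (mixing_transfer H0 r0 eta0 Hrm _ hmU _ (mix V mV) (equi V mV)).
    by rewrite lam_le1// fine_measure_ge0.
  by apply: hm; exact: measurable_iter_preimage.
have decor n := avoids_decorrelation (@measurable_T R alpha) mu_inv mU n m0 short mixing.
have := return_time_exponential (@measurable_T R alpha) mu_inv mU m0
  (dl := 2 * eta + 9 * eta + N%:R * m) decor.
have : N%:R * m <= N%:R * (3 * (H * r)) by rewrite ler_wpM2l.
by rewrite -/m; lra.
Qed.

(** All errors are at most a fixed multiple of [eta]: the density [h] and the good set
are within [eta] of their values at [z], the time [N] has [N * mu (ball z r)] at
most [eta] by the choice of [e3], and the two mixing bounds hold up to [eta]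
from the time [M] on. *)
Lemma return_time_error_small z (dl : R) K1 K2 : 0 < dl -> dl < z -> z < 1 ->
  0 < h z -> lebesgue_pt h z ->
  (leb ((no_long_excursion (alpha := alpha) K1 `&`
         no_fast_return (alpha := alpha) theta dl K2) `&` ball z r)
    * (leb (ball z r))^-1)%E @[r --> 0^'+] --> 1%E ->
  forall e : R, 0 < e -> exists2 r0, 0 < r0 & forall r, 0 < r -> r < r0 ->
    return_time_error T mu (ball_in `[0, 1]%classic z r) <= e.
Proof.
move=> dl0 dlz z1 hz0 hz dens e e0.
set G := no_long_excursion K1 `&` no_fast_return theta dl K2 in dens.
have mG : measurable G.
  by apply: measurableI; [exact: measurable_no_long_excursion|exact: measurable_no_fast_return].
pose H := h z; have H0 : 0 < H by [].
(* 26 = 2 * (2 + 9 + 1) + 2: the errors of early returns, of mixing and of the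
   elapsed time count twice, and so does the measure of the ball. *)
pose eta := Num.min (e / 26) 4^-1.
have eta0 : 0 < eta by rewrite /eta lt_min; lra.
have eta4 : eta <= 4^-1 by rewrite /eta ge_min lexx orbT.
have etae : 26 * eta <= e.
  have : eta <= e / 26 by rewrite /eta ge_min lexx.
  lra.
have eta44 : 0 < eta / 4 by lra.
have [M1 hM1] := ball_mixing alpha0 alpha1 eta0 eta4.
have [M2 hM2] := mu_equidistribution alpha0 alpha1 mu_carrier mu_ac mu_inv mh ih hE eta0.
pose M := maxn M1 M2.
have He0 : 0 < H * eta by rewrite mulr_gt0.
have [r1 r10 hr1] := lebesgue_pt_ball mh ih hE hz He0.
(* The ball has measure at most [3 * H * r] and [N <= 4 * k], hence the 12. *)
pose e3 := eta / (12 * H + 1).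
have H12 : 0 < 12 * H + 1 by lra.
have e30 : 0 < e3 by rewrite divr_gt0.
have e3eta : e3 <= eta by rewrite ler_pdivrMr// ler_peMr//; lra.
have [r2 r20 hr2] := time_scale alpha0 alpha1 (maxn K1 M) th1 th2 e30.
have [r3 r30 hr3] : exists2 r3, 0 < r3 & forall r, 0 < r -> r < r3 ->
    (((1 - eta / 8) * (2 * r))%:E <= leb (G `&` ball z r))%E.
  have /fine_cvgP[fz /cvgrPdist_le cz] := dens.
  have eta8 : 0 < eta / 8 by lra.
  have := filterI fz (cz _ eta8).
  case=> d /= d0 hd; exists d => // r r0 rd.
  have := hd r; rewrite /ball/= sub0r normrN gtr0_norm// => /(_ rd r0)[fr cr].
  have lU : leb (ball z r) = (2 * r)%:E by rewrite lebesgue_measure_ball ?mulr_natl// ltW.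
  have r2' : 0 < 2 * r by lra.
  rewrite lU inver gt_eqF// in fr cr.
  have fG : leb (G `&` ball z r) \is a fin_num.
    rewrite ge0_fin_numE//; apply: (@le_lt_trans _ _ (leb (ball z r))).
      apply: le_measure; rewrite ?inE//; last exact: measurable_ball.
      by apply: measurableI => //; exact: measurable_ball.
    by rewrite lU ltry.
  rewrite -(fineK fG) lee_fin.
  move: cr; rewrite /= fineM// => /ler_normlP[_ cr].
  rewrite -ler_pdivlMr//; move: cr => /=; lra.
have [r4 r40 hr4] : exists2 r4, 0 < r4 & forall r, r < r4 ->
    [/\ r < z - dl, r < 1 - z, r < a K2 / 2 & r < eta / (3 * H)].
  exists (Num.min (Num.min (z - dl) (1 - z)) (Num.min (a K2 / 2) (eta / (3 * H)))).
    by rewrite !lt_min !subr_gt0 dlz z1/= !divr_gt0// ?mulr_gt0// (a_gt0 alpha0 alpha1).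
  by move=> r; rewrite !lt_min => /andP[/andP[? ?] /andP[? ?]].
exists (Num.min (Num.min r1 r2) (Num.min r3 r4)).
  by rewrite !lt_min r10 r20 r30.
move=> r r0; rewrite !lt_min => /andP[/andP[rr1 rr2] /andP[rr3 /hr4[rzd rz1 rK2 rH]]].
have [k [K1Mk akr rscale kr]] := hr2 r r0 rr2.
have [K1k M1k M2k] : [/\ (K1 <= k)%N, (M1 <= k)%N & (M2 <= k)%N].
  by move: K1Mk; rewrite !geq_max => /and3P[].
have [M1M M2M] : (M1 <= M)%N /\ (M2 <= M)%N by rewrite leq_maxl leq_maxr.
have Mk : (M <= k)%N by rewrite geq_max M1k.
pose N := (M + (k + k))%N.
have N4k : (N <= 4 * k)%N.
  apply: (leq_trans (leq_add Mk (leqnn _))).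
  by rewrite !mulSn mul0n addn0 !addnA leq_addr.
have U01 : ball z r `<=` `[0, 1[%classic.
  by move=> x /ball_subset; rewrite /= in_itv/=; lra.
have -> : ball_in `[0, 1]%classic z r = ball z r.
  rewrite /ball_in; apply/setIidPl => x /U01.
  by rewrite /= !in_itv/= => /andP[-> /ltW].
have mU : measurable (ball z r : set X) by exact: measurable_ball.
have lamU : lam (ball z r) = 2 * r.
  by rewrite fine_unit_lebesgue// lebesgue_measure_ball ?mulr_natl// ltW.
have lamUG : lam (ball z r `\` G) <= eta / 4 * r.
  have mGU : measurable (G `&` ball z r : set X) by exact: measurableI.
  have := hr3 r r0 rr3; rewrite -fine_unit_lebesgue; last by move=> x [_ /U01].
  rewrite -[X in (_ <= X)%E -> _]fineK ?fin_num_measure// lee_fin => lGU.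
  have := fine_measure_split (@unit_lebesgue R) mU mG; rewrite lamU setIC.
  by lra.
have akr' : a k <= eta * r by apply: (le_trans akr); rewrite ler_pM2r.
apply: le_trans etae.
apply: (ball_return_error (H := H) (G := G) (M := M) (N := N)) => //.
- exact: hr1.
- move=> x [xU [_ xF]]; apply: (no_fast_return_avoids _ _ rscale N4k); last by split; [|exact: xF].
    by lra.
  by lra.
- move=> V mV; apply: (hM1 M k z r V G) => //.
  + by lra.
  + by lra.
  + by move=> x [xG _]; exact: (no_long_excursion_ge alpha0 alpha1 xG K1k).
- by move=> V mV; exact: hM2.
- have n1 : N%:R <= 4 * k%:R :> R by rewrite -natrM ler_nat.
  have n3 : N%:R * (3 * (H * r)) <= 4 * k%:R * (3 * (H * r)).
    by rewrite ler_wpM2r// !mulr_ge0// ltW.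
  have n4 : H * (k%:R * r) <= H * e3 by rewrite ler_pM2l.
  have n5 : e3 * (12 * H + 1) = eta by rewrite /e3 divfK// gt_eqF.
  by lra.
- by move: rH; rewrite ltr_pdivlMr ?mulr_gt0//; lra.
Qed.

End SmallBalls.

(** * Almost every centre *)
(** An unbounded set would have supremum 0 by convention. *)
Lemma return_time_error_ge0 (R : realType) (T : R -> R)
    (mu : probability (measurableTypeR R) R) (U : set R) :
  0 <= return_time_error T mu U.
Proof.
rewrite /return_time_error; set S := (X in sup X).
have [hS|nS] := pselect (has_sup S); last by rewrite sup_out.
have [[y Sy] ub] := hS.
by apply: le_trans (sup_upper_bound hS Sy); case: Sy => t _ <-.
Qed.

Section AlmostEverywhere.
Context {R : realType}.
Local Notation X := (measurableTypeR R).
Local Notation leb := (@lebesgue_measure R).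
Variable mu : probability X R.
Hypothesis mu_ac : mu `<< leb.

Lemma ae_dominated (P : R -> Prop) : {ae leb, forall x, P x} -> {ae mu, forall x, P x}.
Proof. by move=> [A [mA A0 PA]]; exists A; split=> //; exact: mu_null. Qed.

Lemma ae_unit (P : R -> Prop) (N : set X) : measurable N -> lam N = 0 ->
  (forall x, 0 <= x < 1 -> ~ N x -> P x) -> {ae leb, forall x, 0 <= x < 1 -> P x}.
Proof.
move=> mN N0 h; exists (N `&` `[0, 1[%classic); split.
- by apply: measurableI => //; exact: measurable_unit.
- by rewrite -unit_lebesgueE -[LHS]fineK ?fin_num_measure// N0.
- move=> x /= /not_implyP[x01 nP]; rewrite in_itv/=; split=> //.
  by apply: contrapT => nN; apply: nP; exact: h.
Qed.

End AlmostEverywhere.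

Theorem theorem4p2 (R : realType) (alpha : R) (alpha0 : 0 < alpha)
    (alpha1 : alpha < 1) (mu : probability (measurableTypeR R) R)
    (mu_carrier : mu `[0, 1]%classic = 1%E)
    (mu_ac : mu `<< (@lebesgue_measure R))
    (mu_inv : invariant_measure (T_alpha alpha) mu) :
  exponential_return_time_statistics `[0, 1]%classic (T_alpha alpha) mu.
Proof.
have [h [mh ih hE]] := density_exists mu_ac.
pose theta := (1 + alpha) / 2.
have th1 : alpha < theta by rewrite /theta; lra.
have th2 : theta < 1 by rewrite /theta; lra.
pose a := @a_ R (@left_inv R alpha).
have aP n : 0 < a n by exact: a_gt0.
pose G K1 i K2 := no_long_excursion (alpha := alpha) K1 `&`
  no_fast_return (alpha := alpha) theta (a i) K2.
have mG K1 i K2 : measurable (G K1 i K2).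
  by apply: measurableI; [exact: measurable_no_long_excursion|exact: measurable_no_fast_return].
have leb_pt : {ae mu, forall x, lebesgue_pt h x}.
  apply: (ae_dominated mu_ac); apply: lebesgue_differentiation.
  by apply: open_integrable_locally => //; exact: openT.
have dens : {ae mu, forall x, forall K1 i K2,
    (lebesgue_measure (G K1 i K2 `&` ball x r) * (lebesgue_measure (ball x r))^-1)%E
      @[r --> 0^'+] --> (\1_(G K1 i K2) x)%:E}.
  apply: (ae_dominated mu_ac).
  apply: ae_foralln => K1; apply: ae_foralln => i; apply: ae_foralln => K2.
  exact: (lebesgue_density (mG K1 i K2)).
have long : {ae mu, forall x, 0 <= x < 1 -> exists K, no_long_excursion (alpha := alpha) K x}.
  have [N [mN N0 hN]] := no_long_excursion_ae alpha0 alpha1.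
  exact/(ae_dominated mu_ac)/(ae_unit mN N0 hN).
have fast : {ae mu, forall x, forall i, 0 <= x < 1 ->
    exists K, no_fast_return (alpha := alpha) theta (a i) K x}.
  apply: (ae_dominated mu_ac); apply: ae_foralln => i.
  have [N [mN N0 hN]] := no_fast_return_ae alpha0 alpha1 th1 th2 (aP i).
  exact: (ae_unit mN N0 hN).
have inside : {ae mu, forall x, ~ ([set 0] `|` [set 1]) x}.
  apply: (ae_dominated mu_ac); exists ([set 0] `|` [set 1]); split.
  - by apply: measurableU; exact: measurable_set1.
  - apply/measure_negligible; first by apply: measurableU; exact: measurable_set1.
    by apply: negligibleU; [exists [set 0]|exists [set 1]];
      split=> //; exact: lebesgue_measure_set1.
  - by move=> x /contrapT.
have pos : {ae mu, forall x, ~ ([set x | h x <= 0] `&` `[0, 1[%classic) x}.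
  have mN := measurable_density_nonpos mh.
  exists ([set x | h x <= 0] `&` `[0, 1[%classic); split => //.
    by rewrite -[LHS]fineK ?fin_num_measure// (density_nonpos mh ih hE).
  by move=> x /contrapT.
rewrite /exponential_return_time_statistics.
have aeF := ae_filter_ringOfSetsType mu.
move: leb_pt; apply: filter_app; move: dens; apply: filter_app.
move: long; apply: filter_app; move: fast; apply: filter_app.
move: inside; apply: filter_app; move: pos; apply: filter_app.
apply: aeW => z hp hi hf hl hd hz z01.
have z01' : 0 < z < 1.
  move: z01; rewrite /= in_itv/= !le_eqVlt => /andP[/orP[/eqP z0|->] /orP[/eqP z1|->]] //.
  - by exfalso; apply: hi; left.
  - by exfalso; apply: hi; left.
  - by exfalso; apply: hi; right.
have zunit : 0 <= z < 1 by lra.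
have hz0 : 0 < h z.
  by rewrite ltNge; apply/negP => h0; apply: hp; split=> //=; rewrite in_itv.
have z20 : 0 < z / 2 by lra.
have [i ai] := a_small alpha0 alpha1 z20.
have [K1 GK1] := hl zunit; have [K2 GK2] := hf i zunit.
have {}hd := hd K1 i K2.
rewrite indicE mem_set in hd; last by split.
have aiz : a i < z by rewrite /a; lra.
have z1 : z < 1 by lra.
have small := return_time_error_small alpha0 alpha1 mu_carrier mu_ac mu_inv mh ih hE
  (aP i) aiz z1 hz0 hz hd.
apply/cvgrPdist_le => e e0; have [r0 r00 hr0] := small e e0.
exists r0 => // r /=; rewrite sub0r normrN => rr0 r_gt0.
rewrite gtr0_norm// in rr0.
rewrite sub0r normrN ger0_norm ?return_time_error_ge0//.
exact: hr0.
Qed.
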